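(* Let $M$ be a sub-Riemannian manifold with smooth volume $\mu$, sub-Laplacian $\mathfrak{L}_M$ and heat kernel $h_t(x,y)$. Assume that there exist constants $C_3,C_4,C_7,C_8>0$, $a>0$ and $b\ge0$ such that $$h_t(x,y)\le C_3t^{-\frac b2}\exp\left(-C_4\frac{(\rho(x,y))^2}{t}\right)\quad\text{for all }0<t<1,\ x,y\in M,$$ $$h_t(x,y)\le C_7t^{-\frac a2}\exp\left(-C_8\frac{(\rho(x,y))^2}{t}\right)\quad\text{for all }t\ge1,\ x,y\in M.$$ Let $1+2/a<p<\infty$, $u_0\in L^q(M)$ with $1\le q<\infty$, and $\gamma>0$. Let $f:[0,\infty)\to[0,\infty)$ be a continuous increasing function such that $f(u)\le K_1u^p$ for some constant $K_1>0$. There exists $\varepsilon=\varepsilon(\gamma)>0$ such that, for every $y\in M$, if $$0\le u_0(x)\le\varepsilon h_\gamma(x,y),\qquad x\in M,$$ then there exists a non-negative continuous curve $u:[0,\infty)\to L^q(M)$ which is a global solution to the Cauchy problem $$u_t-\mathfrak{L}_Mu=f(u)\ \ (x\in M,\ t>0),\qquad u(0,x)=u_0(x)\ \ (x\in M)$$ and, moreover, for this $y$, $$0\le u(t,x)\le C\,h_{t+\gamma}(x,y),\qquad x\in M,\ t\in(0,\infty),$$ for some $C=C(\gamma)>0$.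
   Context: For a local orthonormal frame $X_1,\dots,X_k$ of the sub-Riemannian manifold $M$, the horizontal gradient is $\nabla\varphi=\sum_{i=1}^kX_i(\varphi)X_i$, the divergence $\mathrm{div}_\mu X$ is defined by $L_X\mu=(\mathrm{div}_\mu X)\mu$ ($L_X$ the Lie derivative), and the sub-Laplacian is $\mathfrak{L}_M\varphi=\mathrm{div}_\mu(\nabla\varphi)$, i.e. locally $\mathfrak{L}_M=\sum_{i=1}^k\left(X_i^2+(\mathrm{div}_\mu X_i)X_i\right)$. $h_t(x,y)$ is the heat kernel of $u_t-\mathfrak{L}_Mu=0$; it exists, is smooth, symmetric and positive, and satisfies $h_{t+s}(x,y)=\int_Mh_t(x,z)h_s(z,y)\,d\mu_z$. $\rho$ is the Carnot–Carathéodory distance on $M$. The heat semigroup is $e^{t\mathfrak{L}_M}v(x)=\int_Mh_t(x,y)v(y)\,d\mu_y$ for $t>0$, $e^{0\mathfrak{L}_M}v=v$. The Cauchy problem is studied via the integral equation $u(t)=e^{t\mathfrak{L}_M}u_0+\int_0^te^{(t-s)\mathfrak{L}_M}f(u(s))\,ds$; a global solution with initial value $u_0$ is a $u$ satisfying this for all $t\ge0$. The constant $\varepsilon$ does not depend on the particular $u_0$ or $y$. *)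

(* Defs.v *)
From HB Require Import structures.
From mathcomp Require Import all_boot all_order all_algebra.
From mathcomp Require Import all_classical all_reals all_analysis.

Set Implicit Arguments.
Unset Strict Implicit.
Unset Printing Implicit Defensive.

Import Order.TTheory GRing.Theory Num.Theory.
Import numFieldNormedType.Exports.

Local Open Scope classical_set_scope.
Local Open Scope ring_scope.

(* C^oo on an open set U: all iterated directional derivatives of f exist and
   are continuous at every point of U.  For U open in a finite-dimensional
   space this is the usual notion. *)
Definition smooth_on (R : realType) (V W : normedModType R)
    (U : set V) (f : V -> W) : Prop :=
  forall (vs : seq V) (x : V), U x ->
    let g := foldr (fun v (g : V -> W) => 'D_v g) f vs in
    {for x, continuous g} /\ forall v, derivable g x v.

(* Only the values of cmap on cdom, and of cinv on cmap @` cdom, matter. *)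
Record chart (R : realType) (M : ptopologicalType) (n : nat) := Chart {
  cdom : set M;
  cmap : M -> 'rV[R]_n;
  cinv : 'rV[R]_n -> M }.

Definition cim R M n (c : @chart R M n) : set 'rV[R]_n := cmap c @` cdom c.

Definition is_chart R M n (c : @chart R M n) : Prop :=
  [/\ open (cdom c), open (cim c),
      forall x, cdom c x -> cinv c (cmap c x) = x,
      forall x, cdom c x -> {for x, continuous (cmap c)} &
      forall z, cim c z -> {for z, continuous (cinv c)}].

(* A chart chart_at x around each point is part of the data.  It serves to
   identify the tangent space T_x M with R^n, see tder below. *)
Record smooth_manifold (R : realType) (M : ptopologicalType) (n : nat) :=
  SmoothManifold {
    atlas : set (chart R M n);
    chart_at : M -> chart R M n;
    _ : hausdorff_space M;
    _ : @second_countable M;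
    _ : forall c, atlas c -> is_chart c;
    _ : forall c c', atlas c -> atlas c' ->
          smooth_on (cmap c @` (cdom c `&` cdom c')) (cmap c' \o cinv c);
    _ : forall x, atlas (chart_at x) /\ cdom (chart_at x) x }.

Section calculus.
Variables (R : realType) (M : ptopologicalType) (n : nat).
Variable S : smooth_manifold R M n.

(* A tangent vector at x is the vector v of its coordinates in chart_at x;
   tder x v f is the derivative of f at x in the direction v.  In particular
   tder x v (cmap c) is the coordinate vector of v in the chart c. *)
Definition tder (x : M) (v : 'rV[R]_n) (W : normedModType R) (f : M -> W) : W :=
  'D_v (f \o cinv (chart_at S x)) (cmap (chart_at S x) x).

Definition vfield := M -> 'rV[R]_n.

Definition vder (X : vfield) (W : normedModType R) (f : M -> W) : M -> W :=
  fun x => tder x (X x) f.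

Definition smooth_fun (U : set M) (W : normedModType R) (f : M -> W) : Prop :=
  forall c, atlas S c -> smooth_on (cmap c @` (cdom c `&` U)) (f \o cinv c).

Definition smooth_vfield (U : set M) (X : vfield) : Prop :=
  forall c, atlas S c ->
    smooth_on (cmap c @` (cdom c `&` U)) (vder X (cmap c) \o cinv c).

(* [X, Y]^i = X(Y^i) - Y(X^i), in the coordinates of chart_at x. *)
Definition lie_bracket (X Y : vfield) : vfield := fun x =>
  let phi := cmap (chart_at S x) in
  tder x (X x) (vder Y phi) - tder x (Y x) (vder X phi).

(* The Lie algebra of vector fields on U generated by the smooth sections over
   U of the distribution D. *)
Inductive lie_hull (D : M -> {vspace 'rV[R]_n}) (U : set M) : vfield -> Prop :=
| lie_hull_section (X : vfield) :
    smooth_vfield U X -> (forall x, U x -> X x \in D x) -> lie_hull D U X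
| lie_hull_linear (a : R) (X Y : vfield) :
    lie_hull D U X -> lie_hull D U Y ->
    lie_hull D U (fun x => a *: X x + Y x)
| lie_hull_bracket (X Y : vfield) :
    lie_hull D U X -> lie_hull D U Y -> lie_hull D U (lie_bracket X Y).

Definition bracket_generating (D : M -> {vspace 'rV[R]_n}) : Prop :=
  forall (x : M) (v : 'rV[R]_n),
    exists U Z, [/\ open U, U x, lie_hull D U Z & Z x = v].

End calculus.

Definition inner_product_on (R : realType) (n : nat)
    (D : {vspace 'rV[R]_n}) (g : 'rV[R]_n -> 'rV[R]_n -> R) : Prop :=
  [/\ forall u v, u \in D -> v \in D -> g u v = g v u,
      forall (a : R) u v w, u \in D -> v \in D -> w \in D ->
        g (a *: u + v) w = a * g u w + g v w &
      forall u, u \in D -> u != 0 -> 0 < g u u].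

(* A connected smooth manifold with a bracket-generating smooth distribution of
   rank k (a smooth subbundle hor of the tangent bundle, that is, one with
   smooth local frames) and a smooth metric on the distribution. *)
Record subRiemannian (R : realType) (M : ptopologicalType) (n k : nat) :=
  SubRiemannian {
    sr_mfd :> smooth_manifold R M n;
    hor : M -> {vspace 'rV[R]_n};
    metric : M -> 'rV[R]_n -> 'rV[R]_n -> R;
    _ : connected [set: M];
    _ : forall x, inner_product_on (hor x) (metric x);
    _ : forall x, exists (U : set M) (X : 'I_k -> vfield R M n),
          [/\ open U, U x,
              forall i, smooth_vfield sr_mfd U (X i),
              forall y, U y -> basis_of (hor y) [seq X i y | i <- enum 'I_k] &
              forall i j, smooth_fun sr_mfd U
                (fun y => metric y (X i y) (X j y))];
    _ : bracket_generating sr_mfd hor }.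

Section cc_distance.
Variables (R : realType) (M : ptopologicalType) (n k : nat).
Variable S : subRiemannian R M n k.

Definition velocity (c : R -> M) (t : R) : 'rV[R]_n :=
  derive1 (cmap (chart_at S (c t)) \o c) t.

(* Curves on [0, 1], Lipschitz in charts (hence differentiable almost
   everywhere), with horizontal velocity. *)
Definition horizontal_curve (c : R -> M) : Prop :=
  [/\ {within `[0, 1], continuous c},
      forall (phi : chart R M n) (s t : R), atlas S phi ->
        0 <= s -> s <= t -> t <= 1 -> c @` `[s, t] `<=` cdom phi ->
        [lipschitz cmap phi (c r) | r in `[s, t]] &
      {ae (@lebesgue_measure R),
        forall t, `]0, 1[%classic t -> velocity c t \in hor S (c t)}].

Definition curve_length (c : R -> M) : \bar R :=
  (\int[@lebesgue_measure R]_(t in `[0%R, 1%R])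
     (Num.sqrt (metric S (c t) (velocity c t) (velocity c t)))%:E)%E.

(* The infimum is finite (the set of curves is non-empty) by the Chow-Rashevskii
   theorem. *)
Definition cc_dist (x y : M) : R :=
  fine (ereal_inf [set curve_length c | c in
    [set c | [/\ horizontal_curve c, c 0 = x & c 1 = y]]]).

End cc_distance.

Definition borel (M : ptopologicalType) := g_sigma_algebraType (@open M).

Definition box (R : realType) (n : nat) (a b : 'rV[R]_n) : set 'rV[R]_n :=
  [set v | forall i, a ord0 i <= v ord0 i <= b ord0 i].

(* The Lebesgue integral of f over box a b in R^n, as an iterated integral. *)
Fixpoint box_integral (R : realType) (n : nat) :
    'rV[R]_n -> 'rV[R]_n -> ('rV[R]_n -> R) -> \bar R :=
  match n with
  | 0 => fun _ _ f => (f 0)%:E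
  | m.+1 => fun a b f =>
      (\int[@lebesgue_measure R]_(t in `[a ord0 ord0, b ord0 ord0])
         box_integral (rsubmx (a : 'rV[R]_(1 + m)))
                      (rsubmx (b : 'rV[R]_(1 + m)))
                      (fun v => f (row_mx (t%:M : 'M[R]_1) v : 'rV[R]_(1 + m))))%E
  end.

(* A Borel measure which in every chart c has a smooth positive density dens c
   with respect to Lebesgue measure.  Closed boxes generate the Borel sets of
   the image of c, so they determine the measure. *)
Record smooth_volume (R : realType) (M : ptopologicalType) (n : nat)
    (S : smooth_manifold R M n) := SmoothVolume {
  vol :> {measure set (borel M) -> \bar R};
  dens : chart R M n -> 'rV[R]_n -> R;
  _ : forall c, atlas S c -> smooth_on (cim c) (dens c);
  _ : forall c z, atlas S c -> cim c z -> 0 < dens c z;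
  _ : forall c (a b : 'rV[R]_n), atlas S c -> box a b `<=` cim c ->
        vol (cinv c @` box a b) = box_integral a b (dens c) }.

Section sublaplacian.
Variables (R : realType) (M : ptopologicalType) (n k : nat).
Variables (S : subRiemannian R M n k) (mu : smooth_volume S).

(* L_X mu = (div X) mu.  For mu = m dz^1...dz^n and X = sum_i X^i d/dz^i in a
   chart, L_X mu = (sum_i d(m X^i)/dz^i) dz^1...dz^n. *)
Definition divergence (X : vfield R M n) (x : M) : R :=
  let c := chart_at S x in
  let m := dens mu c in
  (m (cmap c x))^-1 *
  \sum_(i < n) 'D_(delta_mx ord0 i)
    (fun z => m z * (vder S X (cmap c) (cinv c z)) ord0 i) (cmap c x).

Definition orthonormal_at (x : M) (e : k.-tuple 'rV[R]_n) : Prop :=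
  (forall i, tnth e i \in hor S x) /\
  (forall i j, metric S x (tnth e i) (tnth e j) = (i == j)%:R).

Definition onb (x : M) : k.-tuple 'rV[R]_n :=
  xget [tuple 0 | _ < k] [set e | orthonormal_at x e].

(* sum_i X_i(phi) X_i.  At a point x this depends only on the orthonormal basis
   X_1(x), ..., X_k(x) of hor S x, and not on its choice. *)
Definition hgrad (phi : M -> R) : vfield R M n := fun x =>
  \sum_(i < k) tder S x (tnth (onb x) i) phi *: tnth (onb x) i.

Definition sublaplacian (phi : M -> R) : M -> R := divergence (hgrad phi).

(* A smooth solution u of u_t = L u on (0, oo) x M such that u(t, .) mu tends
   weakly to the Dirac mass at y as t -> 0+. *)
Definition fundamental_solution (y : M) (u : R -> M -> R) : Prop :=
  [/\ forall c, atlas S c ->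
        smooth_on [set z : R * 'rV[R]_n | 0 < z.1 /\ cim c z.2]
          (fun z => u z.1 (cinv c z.2)),
      forall t x, 0 < t -> derive1 (u ^~ x) t = sublaplacian (u t) x &
      forall phi : M -> R, continuous phi ->
        (exists B : R, forall x, `|phi x| <= B) ->
        ((\int[vol mu]_x (u t x * phi x)%:E)%E @[t --> 0^'+]
           --> (phi y)%:E)].

(* heat_kernel_fundamental and heat_kernel_minimal characterize the heat kernel
   as the minimal non-negative fundamental solution; the other fields are its
   standard properties. *)
Record is_heat_kernel (h : R -> M -> M -> R) : Prop := IsHeatKernel {
  heat_kernel_smooth : forall c c', atlas S c -> atlas S c' ->
    smooth_on
      [set z : R * 'rV[R]_n * 'rV[R]_n |
        [/\ 0 < z.1.1, cim c z.1.2 & cim c' z.2]]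
      (fun z => h z.1.1 (cinv c z.1.2) (cinv c' z.2));
  heat_kernel_gt0 : forall t x y, 0 < t -> 0 < h t x y;
  heat_kernel_sym : forall t x y, 0 < t -> h t x y = h t y x;
  heat_kernel_semigroup : forall t s x y, 0 < t -> 0 < s ->
    (h (t + s) x y)%:E = (\int[vol mu]_z (h t x z * h s z y)%:E)%E;
  heat_kernel_fundamental : forall y, fundamental_solution y (fun t x => h t x y);
  heat_kernel_submarkov : forall t y, 0 < t ->
    (\int[vol mu]_x (h t x y)%:E <= 1)%E;
  heat_kernel_minimal : forall y (u : R -> M -> R),
    (forall t x, 0 < t -> 0 <= u t x) -> fundamental_solution y u ->
    forall t x, 0 < t -> h t x y <= u t x }.

Definition heat_semigroup (h : R -> M -> M -> R) (t : R) (v : M -> R) (x : M)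
    : \bar R :=
  if t == 0 then (v x)%:E else (\int[vol mu]_y (h t x y * v y)%:E)%E.

(* u(t) = e^{tL} u0 + \int_0^t e^{(t-s)L} f(u(s)) ds for all t >= 0, all the
   integrals being absolutely convergent. *)
Definition global_solution (h : R -> M -> M -> R) (f : R -> R) (u0 : M -> R)
    (u : R -> M -> R) : Prop :=
  forall t x, 0 <= t ->
    [/\ 0 < t -> (vol mu).-integrable setT (fun y => (h t x y * u0 y)%:E),
        forall s, 0 <= s -> s < t ->
          (vol mu).-integrable setT (fun y => (h (t - s) x y * f (u s y))%:E),
        (@lebesgue_measure R).-integrable `[0, t]
          (fun s => heat_semigroup h (t - s) (f \o u s) x) &
        (u t x)%:E = (heat_semigroup h t u0 x +
          \int[@lebesgue_measure R]_(s in `[0%R, t])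
            heat_semigroup h (t - s)%R (f \o u s) x)%E].

(* u(t), t >= 0, is a continuous curve in L^q(M); u t is a representative. *)
Definition Lq_curve (q : R) (u : R -> M -> R) : Prop :=
  (forall t, 0 <= t -> (u t : borel M -> R) \in Lfun (vol mu) q%:E) /\
  (forall t, 0 <= t ->
    'N[vol mu]_(q%:E)[EFin \o (u s \- u t)%R]%E
      @[s --> within `[0, +oo[ (nbhs t)] --> 0%E).

End sublaplacian.

(* Main.v *)
Require Import Defs.
From HB Require Import structures.
From mathcomp Require Import all_boot all_order all_algebra.
From mathcomp Require Import all_classical all_reals all_analysis.
From mathcomp Require Import measurable_realfun lebesgue_integral_fubini.
From mathcomp Require Import ring lra.
Import Order.TTheory GRing.Theory Num.Theory.
Import numFieldNormedType.Exports.
Local Open Scope classical_set_scope.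
Local Open Scope ring_scope.

Set Implicit Arguments.
Unset Strict Implicit.
Unset Printing Implicit Defensive.

(** The solution is squeezed under the barrier W(t, x) = C h_(t+gamma)(x, y).
    Since f(v) <= K1 v^p and the kernel decays like t^(-a/2),
      f(W(s, z)) <= K1 C^p (A (s+gamma)^(-a/2))^(p-1) h_(s+gamma)(z, y),
    and the semigroup law turns the Duhamel integral of the right-hand side
    into h_(t+gamma)(x, y) times the integral over [0, t] of
    K1 C^p A^(p-1) (s+gamma)^(-a(p-1)/2).  The assumption p > 1 + 2/a says
    exactly that the exponent a(p-1)/2 exceeds 1, so this integral is bounded
    uniformly in t; because p > 1, a small C makes the bound at most C/2.  If
    the datum is below (C/2) h_gamma, the barrier is therefore a supersolution
    of the integral equation, and monotone iteration from 0 increases to a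
    solution below it ([duhamel_barrier_le], [fixpoint_below_supersolution],
    [mild_solution_exists]).

    Continuity of the curve in L^q reduces to continuity in L^1, because the
    barrier is bounded in (t, x) and |g|^q <= B^(q-1) |g| when |g| <= B.
    Restarting the equation at a time r gives
      u(t) = P_(t-r) u(r) + remainder,
    with a remainder of L^1 norm at most c (t - r) ([mild_restart]).  As P_t
    contracts L^1, continuity of u follows from P_t w -> w in L^1 as t -> 0 for
    integrable w >= 0 ([mild_L1_continuous]).

    That last fact, [L1_continuous_at_start], is the only place where the
    initial condition of the heat kernel enters.  For an open set U of finite
    measure, convergence to the Dirac mass, tested on bump functions, bounds the
    lower limit of P_t 1_U from below by 1_U; since P_t does not increase the
    integral, an argument in the manner of Scheffe upgrades this one-sided
    pointwise bound to L^1 convergence.  A pi-lambda argument passes to Borel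
    sets, and simple functions and dominated convergence to integrable ones.

    All of this is done for an abstract symmetric sub-Markov kernel on a
    sigma-finite measure space.  The heat kernel is one: it is jointly
    continuous in charts and the manifold is second countable, hence it is
    jointly measurable; and because it is positive with integral at most 1, the
    sets where it exceeds 1/i have finite measure and exhaust the manifold, so
    the volume is sigma-finite. *)

(** * Sub-Markov kernels acting on functions *)

Section kernel.
Local Open Scope ereal_scope.
Context d (T : measurableType d) (R : realType).
Variable mu : {sigma_finite_measure set T -> \bar R}.

(** A kernel on all of R that vanishes for t <= 0: the Duhamel integral can
    then run over the whole line, with k (t - s) cutting it off at s = t. *)
Record sub_markov_flow (k : R -> T -> T -> R) : Prop := SubMarkovFlow {
  flow_measurable : measurable_fun [set: (R * (T * T))%type]
    (fun p => k p.1 p.2.1 p.2.2);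
  flow_le0 : forall t x z, (t <= 0)%R -> k t x z = 0%R;
  flow_ge0 : forall t x z, (0 <= k t x z)%R;
  flow_sym : forall t x z, k t x z = k t z x;
  flow_semigroup : forall t s x y, (0 < t)%R -> (0 < s)%R ->
    \int[mu]_z (k t x z * k s z y)%:E = (k (t + s)%R x y)%:E;
  flow_mass : forall t x, \int[mu]_z (k t x z)%:E <= 1;
  flow_bounded : forall t, exists B : R, forall x z, (k t x z <= B)%R }.

Variable k : R -> T -> T -> R.
Hypothesis K : sub_markov_flow k.
Implicit Types (t s : R) (x y z : T) (v w : T -> R).

Definition pos_integrable (v : T -> R) : Prop :=
  [/\ measurable_fun setT v, forall x, (0 <= v x)%R &
      \int[mu]_x (v x)%:E < +oo].

(** The operator P_t of the semigroup, with P_0 the identity.  Values are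
    extended reals so that Tonelli and monotone convergence apply without
    integrability conditions. *)
Definition act (t : R) (v : T -> R) (x : T) : \bar R :=
  if t == 0%R then (v x)%:E else \int[mu]_z (k t x z * v z)%:E.

(** Only meaningful when [act] is finite, as it is on integrable functions. *)
Definition evolve (t : R) (v : T -> R) (x : T) : R := fine (act t v x).

Lemma measurable_flow d' (S : measurableType d') (a : S -> R) (b c : S -> T) :
  measurable_fun setT a -> measurable_fun setT b -> measurable_fun setT c ->
  measurable_fun setT (fun p => k (a p) (b p) (c p)).
Proof.
move=> ma mb mc.
apply: (measurableT_comp (f := fun p : R * (T * T) => k p.1 p.2.1 p.2.2)
          (g := fun p => (a p, (b p, c p)))).
  exact: flow_measurable K.
by apply: measurable_fun_pair => //; exact: measurable_fun_pair.
Qed.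

Lemma act_ge0 t v x : (forall x, (0 <= v x)%R) -> 0 <= act t v x.
Proof.
move=> v0; rewrite /act; case: (t == 0%R); first by rewrite lee_fin.
by apply: integral_ge0 => z _; rewrite lee_fin mulr_ge0 ?(flow_ge0 K).
Qed.

Lemma measurable_integral_flow d' (S : measurableType d')
    (a : S -> R) (b : S -> T) (v : S -> T -> R) :
  measurable_fun setT a -> measurable_fun setT b ->
  measurable_fun [set: (S * T)%type] (fun p => v p.1 p.2) ->
  (forall (p : S) x, (0 <= v p x)%R) ->
  measurable_fun setT (fun p : S => \int[mu]_z (k (a p) (b p) z * v p z)%:E).
Proof.
move=> ma mb mv v0.
apply: (measurable_fun_fubini_tonelli_F (m2 := mu)
  (fun p : S * T => (k (a p.1) (b p.1) p.2 * v p.1 p.2)%:E)).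
  apply/measurable_EFinP; apply: measurable_funM => //.
  apply: measurable_flow => //; exact: measurableT_comp.
by move=> p; rewrite lee_fin mulr_ge0 ?(flow_ge0 K).
Qed.

Lemma measurable_act t v : measurable_fun setT v -> (forall x, (0 <= v x)%R) ->
  measurable_fun setT (act t v).
Proof.
move=> mv v0; rewrite /act; case: (t == 0%R); first exact/measurable_EFinP.
apply: (@measurable_integral_flow _ T (fun=> t) id (fun=> v)) => //.
exact: (measurableT_comp mv measurable_snd).
Qed.

Lemma flow_massr t z : \int[mu]_x (k t x z)%:E <= 1.
Proof.
by under eq_integral do rewrite (flow_sym K); exact: flow_mass K _ _.
Qed.

(** Tonelli and symmetry: the integral of P_t v is that of v against the mass
    of the kernel, which is at most 1. *)
Lemma integral_act_le t v : pos_integrable v ->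
  \int[mu]_x act t v x <= \int[mu]_x (v x)%:E.
Proof.
move=> [mv v0 _]; rewrite /act; case: (t == 0%R) => //.
have mk : measurable_fun [set: T * T] (fun p => k t p.1 p.2).
  by apply: measurable_flow => //; exact: measurable_fst.
rewrite (sfinite_Fubini mu mu (fun p => (k t p.1 p.2 * v p.2)%:E)) //=;
  last 2 first.
- by move=> p; rewrite lee_fin mulr_ge0 ?(flow_ge0 K).
- by apply/measurable_EFinP; apply: measurable_funM => //;
    exact: measurableT_comp.
apply: ge0_le_integral => //.
- by move=> z _; apply: integral_ge0 => x _;
    rewrite lee_fin mulr_ge0 ?(flow_ge0 K).
- apply: (measurable_fun_fubini_tonelli_G (m1 := mu)
    (fun p : T * T => (k t p.1 p.2 * v p.2)%:E)).
    apply/measurable_EFinP; apply: measurable_funM => //;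
      exact: measurableT_comp.
  by move=> p; rewrite lee_fin mulr_ge0 ?(flow_ge0 K).
- exact/measurable_EFinP.
move=> z _; under eq_integral do rewrite mulrC EFinM.
rewrite ge0_integralZl //.
- by rewrite -[leRHS]mule1 lee_wpmul2l ?lee_fin//; exact: flow_massr.
- by apply/measurable_EFinP; apply: measurable_flow.
- by move=> x _; rewrite lee_fin (flow_ge0 K).
- by rewrite lee_fin.
Qed.

(** The kernel is bounded at each positive time, so P_t maps L^1 into bounded
    functions and is finite everywhere, not only almost everywhere. *)
Lemma act_lty t v x : pos_integrable v -> act t v x < +oo.
Proof.
move=> [mv v0 vi]; rewrite /act; case: (t == 0%R); first by rewrite ltry.
have [B kB] := flow_bounded K t.
have B0 : (0 <= B)%R by apply: le_trans (flow_ge0 K t x x) (kB x x).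
apply: (@le_lt_trans _ _ (\int[mu]_z (B%:E * (v z)%:E))).
  apply: ge0_le_integral => //.
  - by move=> z _; rewrite lee_fin mulr_ge0 ?(flow_ge0 K).
  - by apply/measurable_EFinP; apply: measurable_funM => //;
      exact: measurable_flow.
  - by apply: emeasurable_funM => //; exact/measurable_EFinP.
  - by move=> z _; rewrite lee_fin ler_wpM2r.
rewrite ge0_integralZl //.
- by rewrite lte_mul_pinfty.
- exact/measurable_EFinP.
- by move=> z _; rewrite lee_fin.
Qed.

Lemma evolveE t v x : pos_integrable v -> (evolve t v x)%:E = act t v x.
Proof.
move=> iv; rewrite /evolve fineK// ge0_fin_numE ?act_lty//.
by case: iv => _ v0 _; exact: act_ge0.
Qed.

Lemma evolve_ge0 t v x : (forall x, (0 <= v x)%R) -> (0 <= evolve t v x)%R.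
Proof. by move=> v0; apply/fine_ge0/act_ge0. Qed.

Lemma pos_integrable_evolve t v : pos_integrable v ->
  pos_integrable (evolve t v).
Proof.
move=> iv; have [mv v0 vi] := iv; split.
- by apply: measurableT_comp => //; exact: measurable_act.
- by move=> x; exact: evolve_ge0.
- under eq_integral do rewrite evolveE//.
  exact: le_lt_trans (integral_act_le t iv) vi.
Qed.

Lemma evolve0 v : evolve 0 v = v.
Proof. by apply/funext => x; rewrite /evolve /act eqxx. Qed.

Lemma evolveD t s v : (0 <= t)%R -> (0 <= s)%R -> pos_integrable v ->
  evolve t (evolve s v) = evolve (t + s) v.
Proof.
rewrite le_eqVlt => /predU1P[<-|t0]; first by rewrite evolve0 add0r.
rewrite le_eqVlt => /predU1P[<-|s0] iv; first by rewrite evolve0 addr0.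
have [mv v0 vi] := iv.
apply/funext => x; rewrite {1 3}/evolve; congr fine.
rewrite /act (gt_eqF t0) (gt_eqF (addr_gt0 t0 s0)).
under eq_integral => z _.
  rewrite EFinM evolveE// /act gt_eqF// -ge0_integralZl//; last 3 first.
  - by apply/measurable_EFinP; apply: measurable_funM => //;
      exact: measurable_flow.
  - by move=> y _; rewrite lee_fin mulr_ge0 ?(flow_ge0 K).
  - by rewrite lee_fin (flow_ge0 K).
  over.
rewrite (sfinite_Fubini mu mu
  (fun p => (k t x p.1)%:E * (k s p.1 p.2 * v p.2)%:E)) //=; last 2 first.
- by move=> p; rewrite -EFinM lee_fin !mulr_ge0 ?(flow_ge0 K).
- apply: emeasurable_funM; apply/measurable_EFinP.
    by apply: measurable_flow => //; exact: measurable_fst.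
  apply: measurable_funM; last exact: measurableT_comp.
  by apply: measurable_flow => //; exact: measurable_fst.
apply: eq_integral => y _. rewrite EFinM -(flow_semigroup K)// muleC.
rewrite -ge0_integralZl//.
- by apply: eq_integral => z _; rewrite -!EFinM mulrA mulrC.
- by apply/measurable_EFinP; apply: measurable_funM => //;
    exact: measurable_flow.
- by move=> z _; rewrite lee_fin mulr_ge0 ?(flow_ge0 K).
- by rewrite lee_fin.
Qed.

End kernel.

(** * The L1 distance and contractivity *)

Section distance.
Local Open Scope ereal_scope.
Context d (T : measurableType d) (R : realType).
Variable mu : {sigma_finite_measure set T -> \bar R}.
Implicit Types (u v w : T -> R).

Definition L1dist u v : \bar R := \int[mu]_x (`|u x - v x|)%:E.

Lemma measurable_absB u v : measurable_fun setT u -> measurable_fun setT v ->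
  measurable_fun setT (fun x => `|u x - v x|%R).
Proof.
by move=> mu_ mv; apply: measurableT_comp => //; exact: measurable_funB.
Qed.

Lemma L1dist_triangle v u w : measurable_fun setT u -> measurable_fun setT v ->
  measurable_fun setT w -> L1dist u w <= L1dist u v + L1dist v w.
Proof.
move=> mfu mfv mfw; rewrite -ge0_integralD//; last 2 first.
- exact/measurable_EFinP/measurable_absB.
- exact/measurable_EFinP/measurable_absB.
apply: ge0_le_integral => //.
- exact/measurable_EFinP/measurable_absB.
- by apply: emeasurable_funD; exact/measurable_EFinP/measurable_absB.
- move=> x _; rewrite -EFinD lee_fin.
  by rewrite (le_trans _ (ler_normD _ _))// subrKA.
Qed.

Lemma L1distC u v : L1dist u v = L1dist v u.
Proof. by apply: eq_integral => x _; rewrite distrC. Qed.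

Lemma L1distxx u : L1dist u u = 0.
Proof.
rewrite /L1dist; under eq_integral do rewrite subrr normr0.
exact: integral0.
Qed.

Lemma pos_integrable_integrable v : pos_integrable mu v ->
  mu.-integrable setT (EFin \o v).
Proof.
move=> [mv v0 vi]; apply/integrableP; split; first exact/measurable_EFinP.
by under eq_integral => x _ do rewrite /= ger0_norm//.
Qed.

Lemma pos_integrable_le u v : measurable_fun setT u ->
  (forall x, (0 <= u x <= v x)%R) -> pos_integrable mu v -> pos_integrable mu u.
Proof.
move=> mfu uv [mv v0 vi]; split => //.
  by move=> x; case/andP: (uv x).
apply: le_lt_trans vi; apply: ge0_le_integral => //.
- by move=> x _; rewrite lee_fin; case/andP: (uv x).
- exact/measurable_EFinP.
- exact/measurable_EFinP.
- by move=> x _; rewrite lee_fin; case/andP: (uv x).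
Qed.

Lemma pos_integrableD u v : pos_integrable mu u -> pos_integrable mu v ->
  pos_integrable mu (fun x => u x + v x)%R.
Proof.
move=> [mfu u0 ui] [mfv v0 vi]; split.
- exact: measurable_funD.
- by move=> x; rewrite addr_ge0.
under eq_integral do rewrite EFinD.
rewrite ge0_integralD//; try exact/measurable_EFinP.
- exact: lte_add_pinfty.
- by move=> x _; rewrite lee_fin.
- by move=> x _; rewrite lee_fin.
Qed.

Lemma pos_integrableZ (a : R) u : (0 <= a)%R -> pos_integrable mu u ->
  pos_integrable mu (fun x => a * u x)%R.
Proof.
move=> a0 [mfu u0 ui]; split.
- exact: measurable_funM.
- by move=> x; rewrite mulr_ge0.
under eq_integral do rewrite EFinM.
rewrite ge0_integralZl//; first by rewrite lte_mul_pinfty.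
- exact/measurable_EFinP.
- by move=> x _; rewrite lee_fin.
Qed.

Lemma pos_integrable_absB u v : pos_integrable mu u -> pos_integrable mu v ->
  pos_integrable mu (fun x => `|u x - v x|)%R.
Proof.
move=> iu iv; have := pos_integrableD iu iv; apply: pos_integrable_le.
  by apply: measurable_absB; [case: iu|case: iv].
move=> x; rewrite normr_ge0/= (le_trans (ler_normB _ _))//.
by case: iu => _ u0 _; case: iv => _ v0 _; rewrite !ger0_norm.
Qed.

End distance.

Section strong_continuity.
Local Open Scope ereal_scope.
Context d (T : measurableType d) (R : realType).
Variable mu : {sigma_finite_measure set T -> \bar R}.
Variable k : R -> T -> T -> R.
Hypothesis K : sub_markov_flow mu k.
Implicit Types (t s : R) (x y z : T) (u v w : T -> R).

Local Notation evolve := (evolve mu k).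
Local Notation act := (act mu k).
Local Notation L1dist := (L1dist mu).
Local Notation pos_integrable := (pos_integrable mu).

Lemma pos_integrable_flowM t v x : pos_integrable v ->
  pos_integrable (fun z => k t x z * v z)%R.
Proof.
move=> iv; have [mv v0 vi] := iv.
have [B kB] := flow_bounded K t.
have B0 : (0 <= B)%R by apply: le_trans (flow_ge0 K t x x) (kB x x).
apply: pos_integrable_le (pos_integrableZ B0 iv).
  by apply: measurable_funM => //; exact: (measurable_flow K).
by move=> z; rewrite mulr_ge0 ?(flow_ge0 K)//= ler_wpM2r.
Qed.

Lemma evolve_lin t (a b : R) u v w : pos_integrable u -> pos_integrable v ->
  pos_integrable w -> (forall x, u x = a * v x + b * w x)%R ->
  forall x, (evolve t u x = a * evolve t v x + b * evolve t w x)%R.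
Proof.
move=> iu iv iw uE x; rewrite /evolve /act; case: (t == 0%R) => //=.
rewrite -[LHS]/(\int[mu]_z (k t x z * u z))%R.
rewrite (_ : (fun z => _) = (fun z =>
  a * (k t x z * v z) + b * (k t x z * w z))%R); last by apply/funext => z;
    rewrite uE; ring.
have jv := pos_integrable_integrable (pos_integrable_flowM t x iv).
have jw := pos_integrable_integrable (pos_integrable_flowM t x iw).
rewrite RintegralD//.
- by rewrite !RintegralZl.
- have := integrableZl measurableT a jv.
  by apply: eq_integrable.
- have := integrableZl measurableT b jw.
  by apply: eq_integrable.
Qed.

Lemma act_le t u v x : measurable_fun setT u -> measurable_fun setT v ->
  (forall x, (0 <= u x <= v x)%R) -> act t u x <= act t v x.
Proof.
move=> mfu mfv uv; rewrite /act; case: (t == 0%R).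
  by rewrite lee_fin; case/andP: (uv x).
apply: ge0_le_integral => //.
- move=> z _; rewrite lee_fin mulr_ge0 ?(flow_ge0 K)//.
  by case/andP: (uv z).
- by apply/measurable_EFinP; apply: measurable_funM => //;
    exact: (measurable_flow K).
- by apply/measurable_EFinP; apply: measurable_funM => //;
    exact: (measurable_flow K).
- move=> z _; rewrite lee_fin ler_wpM2l ?(flow_ge0 K)//.
  by case/andP: (uv z).
Qed.

(** P_t is linear and positive, so |P_t v - P_t w| <= P_t |v - w| pointwise. *)
Lemma L1dist_evolve t v w : pos_integrable v -> pos_integrable w ->
  L1dist (evolve t v) (evolve t w) <= L1dist v w.
Proof.
move=> iv iw; have ia := pos_integrable_absB iv iw.
apply: le_trans (integral_act_le K t ia).
have [mev _ _] := pos_integrable_evolve K t iv.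
have [mew _ _] := pos_integrable_evolve K t iw.
apply: ge0_le_integral => //.
- exact/measurable_EFinP/measurable_absB.
- by case: ia => ? ? _; exact: (measurable_act K).
move=> x _; rewrite -(evolveE K)// lee_fin /evolve /act.
case: (t == 0%R) => //=.
have jv := pos_integrable_integrable (pos_integrable_flowM t x iv).
have jw := pos_integrable_integrable (pos_integrable_flowM t x iw).
rewrite -/(\int[mu]_z (k t x z * v z))%R -/(\int[mu]_z (k t x z * w z))%R.
rewrite -RintegralB//.
rewrite (le_trans (le_normr_Rintegral _ _))//.
  by have := integrableB measurableT jv jw; apply: eq_integrable.
rewrite -/(\int[mu]_z (k t x z * `|v z - w z|))%R le_eqVlt; apply/orP; left.
apply/eqP; apply: eq_Rintegral => z _.
by rewrite -mulrBr normrM ger0_norm// (flow_ge0 K).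
Qed.

(** Strong continuity of the semigroup at time 0 along v, in L^1. *)
Definition continuous_at_start v : Prop := forall e : R, (0 < e)%R ->
  exists2 r : R, (0 < r)%R &
    forall s, (0 <= s < r)%R -> L1dist (evolve s v) v <= e%:E.

Lemma continuous_at_start_lin (a b : R) u v w : pos_integrable u ->
  pos_integrable v -> pos_integrable w ->
  (forall x, u x = a * v x + b * w x)%R ->
  continuous_at_start v -> continuous_at_start w -> continuous_at_start u.
Proof.
move=> iu iv iw uE cv cw e e0.
pose c : R := (`|a| + `|b| + 1)%R.
have c0 : (0 < c)%R by rewrite ltr_wpDl// addr_ge0.
have ec0 : (0 < e / c)%R by rewrite divr_gt0.
have [rv rv0 hv] := cv _ ec0; have [rw rw0 hw] := cw _ ec0.
exists (Num.min rv rw); first by rewrite lt_min rv0.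
move=> s /andP[s0]; rewrite lt_min => /andP[srv srw].
have [mev _ _] := pos_integrable_evolve K s iv.
have [mew _ _] := pos_integrable_evolve K s iw.
have [meu _ _] := pos_integrable_evolve K s iu.
have [mfv _ _] := iv; have [mfw _ _] := iw; have [mfu _ _] := iu.
apply: (@le_trans _ _ (`|a|%:E * L1dist (evolve s v) v
                       + `|b|%:E * L1dist (evolve s w) w)).
  rewrite -!ge0_integralZl//; try exact/measurable_EFinP/measurable_absB.
  rewrite -ge0_integralD//.
  - apply: ge0_le_integral => //.
    + exact/measurable_EFinP/measurable_absB.
    + by apply: emeasurable_funD; apply: emeasurable_funM => //;
        exact/measurable_EFinP/measurable_absB.
    move=> x _; rewrite -!EFinM -EFinD lee_fin.
    rewrite (evolve_lin s iu iv iw uE) uE -!normrM.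
    rewrite (le_trans _ (ler_normD _ _))// le_eqVlt; apply/orP; left.
    by apply/eqP; congr (`| _ |)%R; ring.
  - by apply: emeasurable_funM => //; exact/measurable_EFinP/measurable_absB.
  - by apply: emeasurable_funM => //; exact/measurable_EFinP/measurable_absB.
apply: (@le_trans _ _ (`|a|%:E * (e / c)%:E + `|b|%:E * (e / c)%:E)).
  by apply: leeD; rewrite lee_wpmul2l ?lee_fin//; [apply: hv|apply: hw];
    rewrite s0.
rewrite -!EFinM -EFinD lee_fin -mulrDl mulrCA ler_piMr ?(ltW e0)//.
by rewrite ler_pdivrMr// mul1r lerDl.
Qed.

Lemma pos_integrable0 : pos_integrable (cst 0%R).
Proof. by split => //; rewrite integral0. Qed.

Lemma continuous_at_start0 : continuous_at_start (cst 0%R).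
Proof.
move=> e e0; exists 1%R => // s _.
rewrite (_ : evolve s _ = cst 0%R) ?L1distxx ?lee_fin ?ltW//.
apply/funext => x; have i0 := pos_integrable0.
rewrite (evolve_lin s (a := 0) (b := 0) i0 i0 i0) ?mul0r ?addr0// => y.
by rewrite !mul0r addr0.
Qed.

(** Contractivity makes the error uniform: replacing v by w costs twice their
    distance. *)
Lemma continuous_at_start_closed v : pos_integrable v ->
  (forall e : R, (0 < e)%R -> exists w,
     [/\ pos_integrable w, continuous_at_start w & L1dist v w <= e%:E]) ->
  continuous_at_start v.
Proof.
move=> iv hv e e0.
have e3 : (0 < e / 3)%R by rewrite divr_gt0.
have [w [iw cw vw]] := hv _ e3; have [r r0 hr] := cw _ e3.
exists r => // s sr.
have [mev _ _] := pos_integrable_evolve K s iv.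
have [mew _ _] := pos_integrable_evolve K s iw.
have [mfv _ _] := iv; have [mfw _ _] := iw.
apply: (le_trans (L1dist_triangle (v := evolve s w) _ _ _ _)) => //.
have -> : e%:E = (e / 3)%:E + ((e / 3)%:E + (e / 3)%:E).
  by rewrite -!EFinD; congr EFin; field.
apply: leeD; first exact: le_trans (L1dist_evolve s iv iw) vw.
apply: (le_trans (L1dist_triangle (v := w) _ _ _ _)) => //.
by apply: leeD; [exact: hr|rewrite L1distC].
Qed.

(** By dominated convergence the approximants converge in L^1, where the
    property is closed. *)
Lemma continuous_at_start_lim (v_ : (T -> R)^nat) v : pos_integrable v ->
  (forall n, measurable_fun setT (v_ n)) ->
  (forall n x, (0 <= v_ n x <= v x)%R) ->
  (forall x, v_ ^~ x @ \oo --> v x) ->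
  (forall n, continuous_at_start (v_ n)) -> continuous_at_start v.
Proof.
move=> iv mv_ v_v cv_ hv_; apply: continuous_at_start_closed => // e e0.
have [mfv v0 vi] := iv.
have iv_ n : pos_integrable (v_ n) by exact: pos_integrable_le iv.
have [_ + _] : [/\ mu.-integrable setT (EFin \o v),
    (fun n => \int[mu]_x `|(v_ n x)%:E - (v x)%:E|) @ \oo --> 0 &
    (fun n => \int[mu]_x (v_ n x)%:E) @ \oo --> \int[mu]_x (v x)%:E].
  apply: (@dominated_convergence _ _ _ mu _ _ (fun n =>
    EFin \o v_ n) _ (EFin \o v)) => //.
  - by move=> n; exact/measurable_EFinP.
  - exact/measurable_EFinP.
  - by apply/aeW => x _; apply: cvg_EFin; [exact: nearW|exact: cv_].
  - exact: pos_integrable_integrable.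
  - apply/aeW => x n _ /=; case/andP: (v_v n x) => v_0 v_le.
    by rewrite lee_fin ger0_norm.
move=> /fine_cvgP[fin /cvgrPdist_le /(_ _ e0) near_e].
near \oo => n.
exists (v_ n); split => //.
have /= finn : (\int[mu]_x `|(v_ n x)%:E - (v x)%:E|) \is a fin_num.
  by near: n; exact: fin.
have : (`|0 - fine (\int[mu]_x `|(v_ n x)%:E - (v x)%:E|)| <= e)%R.
  by near: n; exact: near_e.
rewrite sub0r normrN ger0_norm; last by apply/fine_ge0/integral_ge0.
by rewrite -lee_fin fineK// L1distC.
Unshelve. all: by end_near. Qed.

End strong_continuity.

(** * Strong continuity in L1 at time zero *)

Section strong_continuity_L1.
Local Open Scope ereal_scope.
Import HBNNSimple.
Context d (T : measurableType d) (R : realType).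
Variable mu : {sigma_finite_measure set T -> \bar R}.
Variable k : R -> T -> T -> R.
Hypothesis K : sub_markov_flow mu k.
Implicit Types (t s : R) (x y z : T) (u v w : T -> R).

Local Notation evolve := (evolve mu k).
Local Notation act := (act mu k).
Local Notation L1dist := (L1dist mu).
Local Notation pos_integrable := (pos_integrable mu).
Local Notation continuous_at_start := (continuous_at_start mu k).

(** Pointwise |P v - v| + v = 2 max(0, v - P v) + P v.  Integrating and using
    that the integral of P v is at most that of v leaves only the deficit. *)
Lemma L1dist_evolve_deficit s v : pos_integrable v ->
  L1dist (evolve s v) v <=
  2%:E * \int[mu]_x (Num.max 0 (v x - evolve s v x))%:E.
Proof.
move=> iv; have [mfv v0 vi] := iv.
have [me e0 ei] := pos_integrable_evolve K s iv.
have vfin : \int[mu]_x (v x)%:E \is a fin_num.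
  by rewrite ge0_fin_numE// integral_ge0// => x _; rewrite lee_fin.
have mmax : measurable_fun setT (fun x => Num.max 0 (v x - evolve s v x))%R.
  by apply: measurable_maxr => //; exact: measurable_funB.
rewrite -(leeD2rE _ _ vfin).
rewrite -ge0_integralZl//; last 2 first.
- exact/measurable_EFinP.
- by move=> x _; rewrite lee_fin le_max lexx.
apply: (@le_trans _ _ (\int[mu]_x (2%:E * (Num.max 0 (v x - evolve s v x))%:E)
                       + \int[mu]_x (evolve s v x)%:E)).
  rewrite -!ge0_integralD//; last first.
  - exact/measurable_EFinP.
  - by move=> x _; rewrite lee_fin.
  - exact/measurable_EFinP/measurable_absB.
  - exact/measurable_EFinP.
  - by move=> x _; rewrite lee_fin.
  - by apply: emeasurable_funM => //; exact/measurable_EFinP.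
  - by move=> x _; rewrite -EFinM lee_fin mulr_ge0// le_max lexx.
  rewrite le_eqVlt; apply/orP; left; apply/eqP; apply: eq_integral => x _.
  rewrite -EFinM -!EFinD; congr EFin.
  have [le|lt] := leP (v x - evolve s v x)%R 0%R.
    by rewrite mulr0 add0r ger0_norm ?subrK//; lra.
  by rewrite ltr0_norm; lra.
rewrite leeD2l//; under eq_integral do rewrite (evolveE K)//.
exact: integral_act_le.
Qed.

(** Scheffe's lemma with one-sided hypotheses: a pointwise lower bound on lim
    inf P_s v sends the deficit max(0, v - P_s v) to 0, and this deficit is
    dominated by v. *)
Lemma lsc_continuous_at_start v : pos_integrable v ->
  (forall x (e : R), (0 < e)%R -> exists2 r : R, (0 < r)%R &
     forall s, (0 < s < r)%R -> (v x - e)%:E <= act s v x) ->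
  continuous_at_start v.
Proof.
move=> iv lsc e e0; have [mfv v0 vi] := iv.
have mdef s : measurable_fun setT (fun x => Num.max 0 (v x - evolve s v x))%R.
  have [me _ _] := pos_integrable_evolve K s iv.
  by apply: measurable_maxr => //; exact: measurable_funB.
have : (fun s => \int[mu]_x (Num.max 0 (v x - evolve s v x))%:E) @ 0%R^'+ --> 0.
  apply/cvge_at_rightP => s_ [s_gt0 s_cvg].
  have := @dominated_convergence _ _ _ mu _ measurableT
    (fun n => EFin \o (fun x => Num.max 0 (v x - evolve (s_ n) v x)))%R
    (cst 0) (EFin \o v).
  case.
  - by move=> n; exact/measurable_EFinP.
  - exact: measurable_cst.
  - apply/aeW => x _ /=; apply: cvg_EFin; first exact: nearW.
    apply/cvgrPdist_le => e' e'0; have [r r0 hr] := lsc x _ e'0.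
    move/cvgrPdist_lt : s_cvg => /(_ _ r0); apply: filterS => n.
    rewrite sub0r normrN gtr0_norm// => snr.
    rewrite /= sub0r normrN ger0_norm ?le_max ?lexx// ge_max (ltW e'0)/=.
    have := hr (s_ n); rewrite s_gt0 snr => /(_ isT).
    by rewrite -(evolveE K)// lee_fin lerBlDr lerBlDl.
  - exact: pos_integrable_integrable.
  - apply/aeW => x n _ /=; rewrite lee_fin ger0_norm ?le_max ?lexx//.
    by rewrite ge_max v0/= gerBl evolve_ge0.
  by move=> _ _; rewrite integral0.
move=> /fine_cvgP[fin /cvgrPdist_le].
have e2 : (0 < e / 2)%R by rewrite divr_gt0.
move=> /(_ _ e2) small.
have [r /= r0 hr] : \forall s \near 0%R^'+,
    \int[mu]_x (Num.max 0 (v x - evolve s v x))%:E <= (e / 2)%:E.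
  near=> s.
  have finn : (\int[mu]_x (Num.max 0 (v x - evolve s v x))%:E) \is a fin_num.
    by near: s; exact: fin.
  have : (`|0 - fine (\int[mu]_x (Num.max 0 (v x - evolve s v x))%:E)| <= e /
    2)%R.
    by near: s; exact: small.
  rewrite sub0r normrN ger0_norm; last first.
    by apply/fine_ge0/integral_ge0 => x _; rewrite lee_fin le_max lexx.
  by rewrite -lee_fin fineK.
exists r => // s /andP[]; rewrite le_eqVlt => /predU1P[<- _|s0 sr].
  by rewrite evolve0 L1distxx lee_fin ltW.
apply: (le_trans (L1dist_evolve_deficit s iv)).
have -> : e%:E = 2%:E * (e / 2)%:E by rewrite -EFinM; congr EFin; field.
rewrite lee_wpmul2l// hr//=.
by rewrite /ball/= sub0r normrN gtr0_norm.
Unshelve. all: by end_near. Qed.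

Lemma pos_integrable_indic (A : set T) : measurable A -> mu A < +oo ->
  pos_integrable (\1_A : T -> R).
Proof.
move=> mA fA; split; first exact: measurable_indic.
- by move=> x; rewrite indicE.
- by rewrite integral_indic// setIT.
Qed.

Variable G : set (set T).
Hypothesis GE : @measurable _ T = <<s G >>.
Hypothesis GI : setI_closed G.
Hypothesis Gconc : forall U x (e : R), G U -> U x -> (0 < e)%R ->
  exists2 r : R, (0 < r)%R & forall s, (0 < s < r)%R ->
    (1 - e)%:E <= \int[mu]_z (k s x z * \1_U z)%:E.

Let Gm U : G U -> measurable U.
Proof. by move=> GU; rewrite GE; exact: sub_gen_smallest. Qed.

Let fin_sub A U : measurable A -> measurable U -> A `<=` U -> mu U < +oo ->
  mu A < +oo.
Proof.
by move=> mA mU AU; apply: le_lt_trans; apply: le_measure; rewrite ?inE.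
Qed.

(** Outside U there is nothing to bound from below, since the indicator
    vanishes there. *)
Lemma continuous_at_start_base U : G U -> mu U < +oo ->
  continuous_at_start (\1_U : T -> R).
Proof.
move=> GU fU; apply: lsc_continuous_at_start.
  exact: pos_integrable_indic (Gm GU) fU.
move=> x e e0; have [Ux|nUx] := pselect (U x); last first.
  exists 1%R => // s /andP[s0 _]; rewrite indicE memNset// sub0r.
  apply: (@le_trans _ _ 0); first by rewrite lee_fin oppr_le0 ltW.
  by apply: (act_ge0 K) => z; rewrite indicE.
have [r r0 hr] := Gconc GU Ux e0; exists r => // s /andP[s0 sr].
rewrite indicE mem_set// /act gt_eqF//.
by apply: hr; rewrite s0.
Qed.

(** Dynkin's pi-lambda theorem, relative to U to keep all indicators
    integrable. *)
Lemma continuous_at_start_indic U A : G U -> mu U < +oo -> measurable A ->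
  continuous_at_start (\1_(A `&` U) : T -> R).
Proof.
move=> GU fU mA; have mU := Gm GU.
have iAU B : measurable B -> pos_integrable (\1_(B `&` U) : T -> R).
  move=> mB; apply: pos_integrable_indic; first exact: measurableI.
  by apply: (fin_sub _ mU) => //; exact: measurableI.
have cU := continuous_at_start_base GU fU.
move: A mA; rewrite GE; apply: (dynkin_induction GE GI).
- by rewrite setTI.
- move=> V GV; apply: continuous_at_start_base; first exact: GI.
  by apply: (fin_sub _ mU) => //; apply: measurableI => //; exact: Gm.
- move=> A mA cA.
  apply: (continuous_at_start_lin K (a := 1) (b := -1) _ _ _ _ cU cA).
  + exact/iAU/measurableC.
  + by rewrite -[U]setTI; exact: iAU.
  + exact: iAU.
  + move=> x; rewrite !indicE !in_setI in_setC.
    by case: (x \in A); case: (x \in U) => /=; ring.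
- move=> F mF tF cF.
  have mS n : measurable (\big[setU/set0]_(i < n) F i).
    exact: bigsetU_measurable.
  have mB : measurable (\bigcup_n F n) by exact: bigcup_measurable.
  apply: (continuous_at_start_lim K
    (v_ := fun n => \1_(\big[setU/set0]_(i < n) F i `&` U))).
  + exact: iAU.
  + by move=> n; case: (iAU _ (mS n)).
  + move=> n x; rewrite !indicE ler0n/= ler_nat.
    case: (boolP (x \in _ `&` U)) => // /set_mem[].
    rewrite -bigcup_mkord => -[i _ Fix] Ux.
    by rewrite mem_set//; split => //; exists i.
  + move=> x; rewrite [X in _ --> X]indicE.
    have [[[i _ Fix] Ux]|nx] := pselect ((\bigcup_n F n `&` U) x).
      rewrite mem_set; last by split => //; exists i.
      apply: cvg_near_cst; exists i.+1 => // n /= ltin.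
      rewrite indicE mem_set//; split => //.
      by rewrite -bigcup_mkord; exists i.
    rewrite memNset//; apply: cvg_near_cst; apply: nearW => n.
    rewrite indicE memNset// => -[]; rewrite -bigcup_mkord => -[i _ Fix] Ux.
    by apply: nx; split => //; exists i.
  elim=> [|n IH].
    rewrite big_ord0 set0I indic0; exact: (continuous_at_start0 K).
  apply: (continuous_at_start_lin K (a := 1) (b := 1) _ _ _ _ IH (cF n)).
  + exact: iAU.
  + exact: iAU.
  + exact: iAU.
  move=> x; rewrite !indicE !mul1r -natrD; congr (_%:R)%R.
  rewrite big_ord_recr/= setIUl in_setU.
  case: (boolP (x \in F n `&` U)) => [/set_mem[Fnx Ux]|_];
    last by case: (x \in _).
  rewrite memNset// => -[+ _]; rewrite -bigcup_mkord => -[i /= ltin Fix].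
  have ein : i = n by apply: tF => //; exists x.
  by rewrite ein ltnn in ltin.
Qed.

Variable O : (set T)^nat.
Hypothesis GO : forall n, G (O n).
Hypothesis finO : forall n, mu (O n) < +oo.
Hypothesis exhO : forall x, \forall n \near \oo, O n x.

(** Increasing simple functions are cut off by the sets O n: every level set
    then has finite measure inside a member of G, where
    [continuous_at_start_indic] applies. *)
Theorem L1_continuous_at_start v : pos_integrable v -> continuous_at_start v.
Proof.
move=> iv; have [mfv v0 vi] := iv.
have mev : measurable_fun setT (EFin \o v) by exact/measurable_EFinP.
pose g := nnsfun_approx measurableT mev.
have cvg_g x : g n x @[n --> \oo] --> v x.
  have /fine_cvg := @cvg_nnsfun_approx _ _ _ _ measurableT _ mev
    (fun x _ => v0 x) x Logic.I.
  exact.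
have g_le n x : (g n x <= v x)%R.
  rewrite -(cvg_lim (@Rhausdorff R) (cvg_g x)).
  apply: (nondecreasing_cvgn_le (u_ := fun m => g m x)).
    by move=> a b ab; exact/lefP/nd_nnsfun_approx.
  by apply/cvg_ex; eexists; exact: cvg_g.
have mgO n : measurable_fun setT (fun x => g n x * \1_(O n) x)%R.
  by apply: measurable_funM => //; apply: measurable_indic; exact: Gm.
apply: (continuous_at_start_lim K (v_ := fun n x =>
  (g n x * \1_(O n) x)%R) iv) => //.
- move=> n x; rewrite indicE mulr_ge0//=.
  by case: (x \in O n); rewrite ?mulr1 ?mulr0.
- move=> x; apply: cvg_trans (cvg_g x); apply: near_eq_cvg.
  near=> n; rewrite indicE mem_set ?mulr1//; near: n; exact: exhO.
move=> n.
pose B (r : R) := g n @^-1` [set r].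
have mB (y : R) : measurable (B y).
  by rewrite -[B y]setTI; apply: (measurable_funPT (g n)) => //;
    exact: measurable_set1.
have iB (y : R) : pos_integrable (\1_(B y `&` O n) : T -> R).
  apply: pos_integrable_indic; first by apply: measurableI => //; exact: Gm.
  apply: (fin_sub _ (Gm (GO n))) => //.
  by apply: measurableI => //; exact: Gm.
have cB (y : R) : continuous_at_start (\1_(B y `&` O n) : T -> R).
  exact: continuous_at_start_indic.
pose l : seq R := finmap.enum_fset (fset_set (range (g n))).
have l0 : {in l, forall y : R, (0 <= y)%R}.
  by move=> y; rewrite in_fset_set// => /set_mem[x _ <-].
rewrite (_ : (fun x => _) = (fun x =>
  \sum_(r <- l) r * \1_(B r `&` O n) x)%R); last first.
  apply/funext => x; rewrite fimfunE fsbig_finite//= mulr_suml.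
  by apply: eq_bigr => y _; rewrite indicI mulrA.
suff [] : pos_integrable (fun x => \sum_(r <- l) r * \1_(B r `&` O n) x)%R /\
   continuous_at_start (fun x => \sum_(r <- l) r * \1_(B r `&` O n) x)%R by [].
elim: l l0 => [_|y l IH l0].
  rewrite (_ : (fun x => _) = (cst 0%R)); last first.
    by apply/funext => x; rewrite big_nil.
  by split; [exact: pos_integrable0|exact: (continuous_at_start0 K)].
have [|il cl] := IH; first by move=> z zl; apply: l0; rewrite inE zl orbT.
have y0 : (0 <= y)%R by apply: l0; rewrite inE eqxx.
have iyl : pos_integrable (fun x =>
  \sum_(r <- y :: l) r * \1_(B r `&` O n) x)%R.
  under eq_fun do rewrite big_cons.
  by apply: pos_integrableD => //; exact: pos_integrableZ.
split => //.
apply: (continuous_at_start_lin K (a := y) (b := 1) iyl (iB y) il _ (cB y) cl).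
by move=> x; rewrite big_cons mul1r.
Unshelve. all: by end_near. Qed.

End strong_continuity_L1.

(** * Fixed points below a supersolution *)

Section kleene.
Local Open Scope ereal_scope.
Context d (X : measurableType d) (R : realType).
Variables (A : (X -> R) -> X -> \bar R) (W : X -> R).
Implicit Types (u v : X -> R).
Hypothesis A_ge0 : forall u x, 0 <= A u x.
Hypothesis A_meas : forall u, measurable_fun setT u ->
  measurable_fun setT (A u).
Hypothesis A_homo : forall u v, measurable_fun setT u ->
  measurable_fun setT v ->
  (forall x, (u x <= v x)%R) -> forall x, A u x <= A v x.
Hypothesis A_cvg : forall (u_ : (X -> R)^nat) u,
  (forall n, measurable_fun setT (u_ n)) -> measurable_fun setT u ->
  (forall x, nondecreasing_seq (u_ ^~ x)) ->
  (forall x, u_ ^~ x @ \oo --> u x) ->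
  forall x, A (u_ n) x @[n --> \oo] --> A u x.
Hypothesis mW : measurable_fun setT W.
Hypothesis W_super : forall x, A W x <= (W x)%:E.

Let iterate : (X -> R)^nat := fix U n :=
  if n is m.+1 then fun x => fine (A (U m) x) else cst 0%R.

Let iterate_prop n : [/\ measurable_fun setT (iterate n),
  (forall x, (0 <= iterate n x <= W x)%R),
  (forall x, (iterate n.+1 x)%:E = A (iterate n) x) &
  (forall x, (iterate n x <= iterate n.+1 x)%R)].
Proof.
have AE u : measurable_fun setT u -> (forall x, (u x <= W x)%R) ->
    forall x, (fine (A u x))%:E = A u x /\ A u x <= (W x)%:E.
  move=> mu_ uW x; have AW : A u x <= (W x)%:E.
    by apply: le_trans (W_super x); exact: A_homo.
  by split => //; rewrite fineK// ge0_fin_numE// (le_lt_trans AW) ?ltry.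
have W0 x : (0 <= W x)%R.
  by rewrite -lee_fin (le_trans _ (W_super x)).
elim: n => [|n [mU U0W UE Umono]].
  have m0 : measurable_fun setT (cst 0%R : X -> R) by exact: measurable_cst.
  split => //= x; first by rewrite lexx W0.
    by case: (AE _ m0 W0 x).
  by rewrite fine_ge0.
have UW x : (iterate n x <= W x)%R by case/andP: (U0W x).
have mU' : measurable_fun setT (iterate n.+1).
  by apply: measurableT_comp => //; exact: A_meas.
have U'W x : (iterate n.+1 x <= W x)%R.
  by rewrite -lee_fin UE; case: (AE _ mU UW x).
have U'E x : (iterate n.+2 x)%:E = A (iterate n.+1) x.
  by case: (AE _ mU' U'W x).
split => //.
- by move=> x; rewrite U'W andbT fine_ge0.
- by move=> x; rewrite -lee_fin U'E UE; exact: A_homo.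
Qed.

(** Kleene's argument: the iterates of 0 increase, stay below the supersolution
    W, and continuity of A along increasing sequences passes to the limit. *)
Theorem fixpoint_below_supersolution : exists u : X -> R,
  [/\ measurable_fun setT u, forall x, (0 <= u x <= W x)%R &
      forall x, (u x)%:E = A u x].
Proof.
have mU n : measurable_fun setT (iterate n) by case: (iterate_prop n).
have UW n x : (0 <= iterate n x <= W x)%R by case: (iterate_prop n).
have UE n x : (iterate n.+1 x)%:E = A (iterate n) x by case: (iterate_prop n).
have Umono x : nondecreasing_seq (iterate ^~ x).
  by apply/nondecreasing_seqP => n; case: (iterate_prop n).
pose u x := limn (iterate ^~ x).
have cU x : iterate ^~ x @ \oo --> u x.
  apply: nondecreasing_is_cvgn => //.
  by exists (W x) => _ [n _ <-]; case/andP: (UW n x).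
have mfu : measurable_fun setT u.
  by apply: (measurable_fun_cvg (h := iterate)) => // x _; exact: cU.
exists u; split => // x.
  apply/andP; split.
    by apply: limr_ge; [exact: cU|apply: nearW => n; case/andP: (UW n x)].
  by apply: limr_le; [exact: cU|apply: nearW => n; case/andP: (UW n x)].
have lim1 : (iterate n.+1 x)%:E @[n --> \oo] --> (u x)%:E.
  apply: cvg_EFin; first exact: nearW.
  by have := cU x; rewrite -cvg_shiftS.
have lim2 : (iterate n.+1 x)%:E @[n --> \oo] --> A u x.
  by under eq_cvg do rewrite UE; exact: A_cvg.
by rewrite -(cvg_lim _ lim1)// (cvg_lim _ lim2).
Qed.

End kleene.

(** * Integrability of the decay rate *)

(** The primitive (1 - ka)^-1 (s + c)^(1 - ka) is increasing and negative, so
    the integral stays below minus its value at 0, for every t. *)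
Lemma integral_powR_shift_le (R : realType) (c ka t : R) :
  0 < c -> 1 < ka -> 0 <= t ->
  (\int[@lebesgue_measure R]_(s in `[0%R, t]) ((s + c) `^ (- ka))%:E <=
   (c `^ (1 - ka) / (ka - 1))%:E)%E.
Proof.
move=> c0 ka1; rewrite le_eqVlt => /predU1P[<-|t0].
  rewrite set_itv1 integral_set1 lee_fin divr_ge0 ?powR_ge0//; lra.
pose F (s : R) := (1 - ka)^-1 * (s + c) `^ (1 - ka).
have dF (s : R) : - c < s -> is_derive s (1 : R) F ((s + c) `^ (- ka)).
  move=> sc; have sc0 : 0 < s + c by lra.
  have D1 := is_derive1_powR (1 - ka) sc0.
  have D2 : is_derive s (1 : R) (fun s : R => s + c) 1.
    by apply: is_derive_eq; rewrite addr0.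
  apply: is_derive_eq.
    exact: (is_deriveZ (1 - ka)^-1
      (@is_derive1_comp _ (fun x => x `^ (1 - ka)) (fun s =>
        s + c) s _ _ D1 D2)).
  rewrite mulr1 [_ *: _]mulrA mulVf ?mul1r; last by lra.
  by congr (_ `^ _); lra.
have cF (s : R) : - c < s -> {for s, continuous F}.
  by move=> /dF D; apply: differentiable_continuous; apply/derivable1_diffP;
    case: D.
rewrite (@continuous_FTC2 _ (fun s => (s + c) `^ (- ka)) F 0 t t0).
- rewrite -EFinB lee_fin /F add0r.
  have := powR_ge0 (t + c) (1 - ka); have := powR_ge0 c (1 - ka).
  set x := c `^ _; set y := (t + c) `^ _ => x0 y0.
  have -> : (1 - ka)^-1 = - (ka - 1)^-1 by rewrite -invrN opprB.
  have : 0 <= (ka - 1)^-1 * y by rewrite mulr_ge0// invr_ge0; lra.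
  by rewrite [x / _]mulrC; lra.
- apply: continuous_in_subspaceT => s; rewrite inE/= in_itv/= => /andP[s0 _].
  have sc0 : 0 < s + c by lra.
  have D1 := is_derive1_powR (- ka) sc0.
  have D2 : is_derive s (1 : R) (fun s : R => s + c) 1.
    by apply: is_derive_eq; rewrite addr0.
  have [D _] := @is_derive1_comp _ (fun x => x `^ (- ka)) (fun s =>
    s + c) s _ _ D1 D2.
  by apply: differentiable_continuous; apply/derivable1_diffP.
- split.
  + move=> s; rewrite in_itv/= => /andP[s0 _].
    by have [] : is_derive s (1 : R) F ((s + c) `^ (- ka)) by apply: dF; lra.
  + by apply: cvg_at_right_filter; apply: cF; lra.
  + by apply: cvg_at_left_filter; apply: cF; lra.
- move=> s; rewrite in_itv/= => /andP[s0 _].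
  rewrite derive1E; have D : is_derive s (1 : R) F ((s + c) `^ (- ka))
    by apply: dF; lra.
  exact: derive_val.
Qed.

(** * The Duhamel integral *)

Section duhamel.
Local Open Scope ereal_scope.
Context d (T : measurableType d) (R : realType).
Variable mu : {sigma_finite_measure set T -> \bar R}.
Variable k : R -> T -> T -> R.
Hypothesis K : sub_markov_flow mu k.
Implicit Types (t s : R) (x y z : T) (u v w : T -> R) (F : R -> T -> R).

Local Notation evolve := (evolve mu k).
Local Notation act := (act mu k).
Local Notation pos_integrable := (pos_integrable mu).

Let lam : {sigma_finite_measure set (measurableTypeR R) -> \bar R} :=
  @lebesgue_measure R.

(** Integrating over the whole line is harmless: the kernel vanishes for s >=
    t, and the sources considered vanish for s < 0. *)
Definition duhamel F t x : \bar R :=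
  \int[@lebesgue_measure R]_s \int[mu]_z (k (t - s) x z * F s z)%:E.

Definition curve_measurable F : Prop :=
  measurable_fun [set: R * T] (fun p => F p.1 p.2).

Lemma measurable_source F s : curve_measurable F -> measurable_fun setT (F s).
Proof.
move=> mF; exact: (measurableT_comp mF
  (measurable_fun_pair (measurable_cst s) (@measurable_id _ _ _))).
Qed.

Lemma flow_source_ge0 F t s x : (forall s x, (0 <= F s x)%R) ->
  0 <= \int[mu]_z (k (t - s) x z * F s z)%:E.
Proof.
by move=> F0; apply: integral_ge0 => z _;
  rewrite lee_fin mulr_ge0// (flow_ge0 K).
Qed.

Lemma duhamel_ge0 F t x : (forall s x, (0 <= F s x)%R) -> 0 <= duhamel F t x.
Proof. by move=> F0; apply: integral_ge0 => s _; exact: flow_source_ge0. Qed.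

Lemma measurable_flow_source F t x : curve_measurable F ->
  (forall s x, (0 <= F s x)%R) ->
  measurable_fun setT (fun s => \int[mu]_z (k (t - s) x z * F s z)%:E).
Proof.
move=> mF F0.
apply: (@measurable_integral_flow _ _ _ mu k K _ R (fun s =>
  t - s)%R (fun=> x) F) => //.
exact: measurable_funB.
Qed.

Lemma measurable_duhamel F : curve_measurable F ->
  (forall s x, (0 <= F s x)%R) ->
  measurable_fun [set: R * T] (fun p => duhamel F p.1 p.2).
Proof.
move=> mF F0.
apply: (measurable_fun_fubini_tonelli_F (m2 := lam)
  (fun p : (R * T) * measurableTypeR R =>
    \int[mu]_z (k (p.1.1 - p.2) p.1.2 z * F p.2 z)%:E)); last first.
  by move=> p; exact: flow_source_ge0.
apply: (@measurable_integral_flow _ _ _ mu k K _ ((R * T) * R)%type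
  (fun p => p.1.1 - p.2)%R (fun p => p.1.2) (fun p => F p.2)) => //.
- by apply: measurable_funB => //; exact: measurableT_comp.
- exact: measurableT_comp.
- apply: (measurableT_comp (f := fun p =>
    F p.1 p.2) (g := fun q : (R * T) * R * T => (q.1.2, q.2))) => //.
  by apply: measurable_fun_pair => //; exact: measurableT_comp.
Qed.

Lemma duhamel_homo F1 F2 t x : curve_measurable F1 -> curve_measurable F2 ->
  (forall s z, (0 <= F1 s z)%R) -> (forall s z, (F1 s z <= F2 s z)%R) ->
  duhamel F1 t x <= duhamel F2 t x.
Proof.
move=> m1 m2 F10 F12.
have F20 s z : (0 <= F2 s z)%R by exact: le_trans (F12 s z).
apply: ge0_le_integral => //.
- by move=> s _; exact: flow_source_ge0.
- exact: measurable_flow_source.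
- exact: measurable_flow_source.
move=> s _; apply: ge0_le_integral => //.
- by move=> z _; rewrite lee_fin mulr_ge0// (flow_ge0 K).
- apply/measurable_EFinP; apply: measurable_funM; last exact: measurable_source.
  exact: (measurable_flow K).
- apply/measurable_EFinP; apply: measurable_funM; last exact: measurable_source.
  exact: (measurable_flow K).
- by move=> z _; rewrite lee_fin ler_wpM2l// (flow_ge0 K).
Qed.

(** Monotone convergence twice, in space and then in time. *)
Lemma duhamel_cvg (F_ : (R -> T -> R)^nat) F t x :
  (forall n, curve_measurable (F_ n)) -> curve_measurable F ->
  (forall n s z, (0 <= F_ n s z)%R) ->
  (forall s z, nondecreasing_seq (fun n => F_ n s z)) ->
  (forall s z, F_ n s z @[n --> \oo] --> F s z) ->
  duhamel (F_ n) t x @[n --> \oo] --> duhamel F t x.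
Proof.
move=> mF_ mF F_0 F_nd F_cvg.
have F0 s z : (0 <= F s z)%R.
  rewrite -(cvg_lim (@Rhausdorff R) (F_cvg s z)); apply: limr_ge.
    by apply/cvg_ex; eexists; exact: F_cvg.
  by apply: nearW => n; exact: F_0.
have inner s : \int[mu]_z (k (t - s) x z * F_ n s z)%:E @[n --> \oo] -->
    \int[mu]_z (k (t - s) x z * F s z)%:E.
  rewrite (_ : \int[mu]_z (k (t - s) x z * F s z)%:E =
     \int[mu]_z limn (fun n => (k (t - s) x z * F_ n s z)%:E)).
    apply: (@cvg_monotone_convergence _ _ _ mu _ measurableT
       (fun n z => (k (t - s) x z * F_ n s z)%:E)).
    - move=> n; apply/measurable_EFinP; apply: measurable_funM;
        last exact: measurable_source.
      exact: (measurable_flow K).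
    - by move=> n z _; rewrite lee_fin mulr_ge0// (flow_ge0 K).
    - move=> z _ a b ab; rewrite lee_fin ler_wpM2l ?(flow_ge0 K)//.
      exact: F_nd.
  apply: eq_integral => z _; apply/esym/cvg_lim => //.
  apply: cvg_EFin; first exact: nearW.
  by apply: cvgM; [exact: cvg_cst|exact: F_cvg].
rewrite (_ : duhamel F t x = \int[@lebesgue_measure R]_s limn (fun n =>
  \int[mu]_z (k (t - s) x z * F_ n s z)%:E)).
  apply: (@cvg_monotone_convergence _ _ _ lam _ measurableT
       (fun n s => \int[mu]_z (k (t - s) x z * F_ n s z)%:E)).
  - by move=> n; exact: measurable_flow_source.
  - by move=> n s _; exact: flow_source_ge0.
  - move=> s _ a b ab; apply: ge0_le_integral => //.
    + by move=> z _; rewrite lee_fin mulr_ge0// (flow_ge0 K).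
    + apply/measurable_EFinP; apply: measurable_funM;
        last exact: measurable_source.
      exact: (measurable_flow K).
    + apply/measurable_EFinP; apply: measurable_funM;
        last exact: measurable_source.
      exact: (measurable_flow K).
    + move=> z _; rewrite lee_fin ler_wpM2l ?(flow_ge0 K)//; exact: F_nd.
by apply: eq_integral => s _; apply/esym/cvg_lim.
Qed.

Lemma measurable_evolve_curve v : measurable_fun setT v ->
  (forall x, (0 <= v x)%R) ->
  curve_measurable (fun t => evolve t v).
Proof.
move=> mv v0; rewrite /curve_measurable /evolve /act;
  apply: measurableT_comp => //.
apply: measurable_fun_ifT.
- by apply: measurable_fun_eqr.
- by apply/measurable_EFinP; exact: measurableT_comp.
- apply: (@measurable_integral_flow _ _ _ mu k K _ (R * T)%type fst snd (fun=>
    v)) => //.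
  exact: (measurableT_comp mv measurable_snd).
Qed.

Lemma pos_integrable_flow t y : pos_integrable (k t ^~ y).
Proof.
split; first exact: (measurable_flow K).
- by move=> x; exact: flow_ge0 K _ _ _.
- by apply: le_lt_trans (ltry 1); exact: (flow_massr K).
Qed.

Lemma act_flow t s x y : (0 <= t)%R -> (0 < s)%R ->
  act t (k s ^~ y) x = (k (t + s) x y)%:E.
Proof.
rewrite /act le_eqVlt => /predU1P[<-|t0] s0; first by rewrite eqxx add0r.
by rewrite gt_eqF// (flow_semigroup K).
Qed.

(** Replaces the integral over the line by the integral of P_(t-s) F(s) over
    [0, t]; the integrands differ only at s = t, where P_0 is the identity
    while the kernel is 0. *)
Lemma duhamel_act F t x : (0 <= t)%R -> curve_measurable F ->
  (forall s z, (0 <= F s z)%R) -> (forall s z, (s < 0)%R -> F s z = 0%R) ->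
  measurable_fun `[0%R, t] (fun s => act (t - s) (F s) x) /\
  \int[@lebesgue_measure R]_(s in `[0%R, t]) act (t - s) (F s)
    x = duhamel F t x.
Proof.
move=> t0 mF F0 F_past.
have actE s : `[0%R, t[%classic s ->
    act (t - s) (F s) x = \int[mu]_z (k (t - s) x z * F s z)%:E.
  by rewrite /= in_itv/= => /andP[_ st]; rewrite /act subr_eq0 gt_eqF.
have mact : measurable_fun `[0%R, t[ (fun s => act (t - s) (F s) x).
  apply: (eq_measurable_fun (fun s => \int[mu]_z (k (t - s) x z * F s z)%:E)).
    by move=> s; rewrite inE => /actE.
  by apply: measurable_funTS; exact: measurable_flow_source.
split; first exact/emeasurable_fun_itv_bndo_bndcP.
rewrite -integral_itv_bndo_bndc// /duhamel [LHS]integral_mkcond.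
apply: eq_integral => s _; rewrite patchE; case: ifPn => [|/negP nst].
  by rewrite inE => /actE.
apply/esym/integral0_eq => z _.
have [s0|s0] := leP 0%R s; last by rewrite F_past// mulr0.
rewrite (flow_le0 K) ?mul0r// leNgt subr_gt0; apply/negP => st; apply: nst.
by rewrite inE/= in_itv/= s0.
Qed.

End duhamel.

(** * Existence of mild solutions under the barrier *)

Section mild_solution.
Local Open Scope ereal_scope.
Context d (T : measurableType d) (R : realType).
Variable mu : {sigma_finite_measure set T -> \bar R}.
Variable k : R -> T -> T -> R.
Hypothesis K : sub_markov_flow mu k.
Variables (gamma A alpha p K1 : R) (f : R -> R).
Hypothesis gamma_gt0 : (0 < gamma)%R.
Hypothesis A_gt0 : (0 < A)%R.
Hypothesis decay : forall t x y, (gamma <= t)%R ->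
  (k t x y <= A * t `^ (- alpha))%R.
Hypothesis p_gt1 : (1 < p)%R.
Hypothesis supercritical : (1 < alpha * (p - 1))%R.
Hypothesis f_ge0 : forall v : R, (0 <= v -> 0 <= f v)%R.
Hypothesis f_cont : {within `[0%R, +oo[, continuous f}.
Hypothesis f_incr : forall v w : R, (0 <= v -> v <= w -> f v <= f w)%R.
Hypothesis K1_gt0 : (0 < K1)%R.
Hypothesis f_le : forall v : R, (0 <= v -> f v <= K1 * v `^ p)%R.
Implicit Types (t s : R) (x y z : T) (v w : T -> R) (u : R -> T -> R).

Local Notation evolve := (evolve mu k).
Local Notation act := (act mu k).
Local Notation pos_integrable := (pos_integrable mu).
Local Notation duhamel := (duhamel mu k).

Local Notation kappa := (alpha * (p - 1))%R.
Local Notation rate c := (K1 * c%R `^ p * A `^ (p - 1))%R.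

Lemma f_at0 : f 0 = 0%R.
Proof.
apply/eqP; rewrite eq_le f_ge0// andbT.
have p0 : p != 0%R by rewrite gt_eqF// (lt_trans ltr01).
by have := f_le (lexx 0%R); rewrite powR0 ?mulr0.
Qed.

(** One power of the kernel is kept, to be used in the semigroup law, and the
    other p - 1 powers are estimated by the decay. *)
Lemma source_le (c : R) t z y : (0 <= c)%R -> (gamma <= t)%R ->
  (f (c * k t z y) <= rate c * t `^ (- kappa) * k t z y)%R.
Proof.
move=> c0 gt; have t0 : (0 < t)%R by exact: lt_le_trans gt.
have k0 := flow_ge0 K t z y.
apply: le_trans (f_le _) _; first by rewrite mulr_ge0.
rewrite powRM// -!mulrA ler_pM2l// ler_wpM2l ?powR_ge0//.
have -> : (k t z y `^ p = k t z y `^ (p - 1) * k t z y)%R.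
  have [k1|k1] := eqVneq (k t z y) 0%R.
    by rewrite k1 mulr0 powR0// gt_eqF// (lt_trans ltr01).
  rewrite -[X in _ = (_ * X)%R](powRr1 k0) -powRD ?subrK//.
  by apply/implyP.
rewrite mulrA ler_wpM2r//.
have -> : (- kappa = - alpha * (p - 1))%R by rewrite mulNr.
rewrite powRrM -powRM ?powR_ge0 ?(ltW A_gt0)//.
have p10 : (0 <= p - 1)%R by rewrite subr_ge0 ltW.
apply: ge0_ler_powR; rewrite ?nnegrE//.
- by rewrite mulr_ge0 ?powR_ge0 ?(ltW A_gt0).
- exact: decay.
Qed.

Let barrier (c : R) y t x : R :=
  if (0 <= t)%R then (c * k (t + gamma) x y)%R else 0%R.

Let barrier_meas c y : curve_measurable (barrier c y).
Proof.
apply: measurable_fun_ifT => //.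
- exact: measurable_fun_ler.
- apply: measurable_funM => //; apply: (measurable_flow K) => //.
  exact: measurable_funD.
Qed.

Let f_max u : R -> T -> R := fun s z => f (Num.max 0%R (u s z)).

Let continuous_f_max : continuous (fun v : R => f (Num.max 0%R v)).
Proof.
move=> v; have max0 (r : R) : (0 <= Num.max 0 r)%R by rewrite le_max lexx.
have /subspace_continuousP /(_ (Num.max 0%R v)) cf := f_cont.
apply: (@cvg_comp _ _ _ (fun r : R => Num.max 0%R r) f _
  (within `[0%R, +oo[ (nbhs (Num.max 0%R v)))); last first.
  by apply: cf; rewrite /= in_itv/= andbT.
move=> B; rewrite /within/= => nB.
have cm : (fun r : R => Num.max 0%R r) @ v --> Num.max 0%R v.
  apply: (@cvg_comp _ _ _ (fun r : R => (0%R : R, r))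
    (fun q : R * R => Order.Def.max q.1 q.2) _ (nbhs (0%R : R, v : R))).
    exact: (cvg_pair (cvg_cst (0%R : R)) (@cvg_id _ (nbhs (v : R)))).
  exact: (@max_continuous _ R (0%R, v)).
have nB' : \forall r \near v, `[0%R, +oo[%classic (Num.max 0%R r) ->
    B (Num.max 0%R r) by exact: cm _ nB.
rewrite nbhs_simpl/=; apply: filterS nB' => r; apply.
by rewrite /= in_itv/= andbT.
Qed.

Let f_max_ge0 u s z : (0 <= f_max u s z)%R.
Proof. by apply: f_ge0; rewrite le_max lexx. Qed.

Let f_max_meas u : curve_measurable u -> curve_measurable (f_max u).
Proof.
move=> mfu; apply: (measurableT_comp (f := fun r : R => f (Num.max 0%R r))) mfu.
exact: continuous_measurable_fun.
Qed.

(** The semigroup law makes the inner integral a multiple of k (t + gamma) x y;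
    what is left is the integral of (s + gamma)^(-kappa), bounded since kappa >
    1. *)
Lemma duhamel_barrier_le (c : R) y t x : (0 <= c)%R -> (0 <= t)%R ->
  duhamel (f_max (barrier c y)) t x <=
  (rate c * (gamma `^ (1 - kappa) / (kappa - 1)) * k (t + gamma) x y)%:E.
Proof.
move=> c0 t0; have rate0 : (0 <= rate c)%R.
  by rewrite !mulr_ge0 ?powR_ge0// ltW.
have ratek0 z : (0 <= rate c * k (t + gamma) z y)%R.
  by rewrite mulr_ge0// (flow_ge0 K).
have mfb := f_max_meas (barrier_meas c y).
have mpow : measurable_fun setT (fun s : R => (s + gamma) `^ (- kappa))%R.
  apply: (measurableT_comp (measurable_powR _)); exact: measurable_funD.
apply: (@le_trans _ _ (\int[@lebesgue_measure R]_(s in `[0%R, t])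
   ((rate c * k (t + gamma) x y)%:E * ((s + gamma) `^ (- kappa))%:E)));
     last first.
  rewrite ge0_integralZl//; first last.
  - by rewrite lee_fin mulr_ge0// (flow_ge0 K).
  - by move=> s _; rewrite lee_fin powR_ge0.
  - by apply/measurable_EFinP; exact: measurable_funTS.
  rewrite [leRHS](_ : _ = (rate c * k (t + gamma) x y)%:E *
      (gamma `^ (1 - kappa) / (kappa - 1))%:E); last by rewrite -EFinM mulrAC.
  rewrite lee_wpmul2l ?lee_fin//.
  exact: integral_powR_shift_le.
rewrite [leRHS]integral_mkcond; apply: ge0_le_integral => //.
- by move=> s _; exact: flow_source_ge0.
- by apply: measurable_flow_source.
- apply/(measurable_restrictT _ _).1 => //.
  by apply/measurable_EFinP; apply: measurable_funM => //;
    exact: measurable_funTS.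
move=> s _; rewrite patchE.
case: ifPn => [|/negP nst]; last first.
  rewrite le_eqVlt; apply/orP; left; apply/eqP; apply: integral0_eq => z _.
  have [s0|s0] := leP 0%R s.
    rewrite (flow_le0 K) ?mul0r// leNgt subr_gt0; apply/negP => st; apply: nst.
    by rewrite inE/= in_itv/= s0 ltW.
  by rewrite /f_max /barrier leNgt s0/= maxxx f_at0 mulr0.
rewrite inE/= in_itv/= => /andP[s0].
rewrite le_eqVlt => /predU1P[->|st].
  rewrite integral0_eq; last first.
    by move=> z _; rewrite (flow_le0 K) ?mul0r// subrr.
  by rewrite -EFinM lee_fin mulr_ge0 ?powR_ge0//.
have -> : (t + gamma = (t - s) + (s + gamma))%R by rewrite addrA subrK.
have sg0 : (0 < s + gamma)%R by rewrite ltr_wpDl.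
have ts0 : (0 < t - s)%R by rewrite subr_gt0.
rewrite [(rate c * _)%:E]EFinM -(flow_semigroup K _ _ ts0 sg0).
rewrite muleAC -EFinM -ge0_integralZl//; first last.
- by rewrite lee_fin mulr_ge0// powR_ge0.
- by move=> z _; rewrite lee_fin mulr_ge0 ?(flow_ge0 K).
- by apply/measurable_EFinP; apply: measurable_funM; apply: (measurable_flow K).
apply: ge0_le_integral => //.
- by move=> z _; rewrite lee_fin mulr_ge0 ?(flow_ge0 K).
- apply/measurable_EFinP; apply: measurable_funM;
    first exact: (measurable_flow K).
  exact: measurable_source.
- apply: emeasurable_funM => //; apply/measurable_EFinP.
  by apply: measurable_funM; apply: (measurable_flow K).
- move=> z _; rewrite -EFinM lee_fin mulrCA ler_wpM2l ?(flow_ge0 K)//.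
  rewrite /f_max /barrier s0 max_r ?mulr_ge0 ?(flow_ge0 K)//.
  by apply: source_le => //; rewrite lerDr.
Qed.

Lemma evolve_datum_le (e : R) v t x y : (0 <= e)%R -> (0 <= t)%R ->
  measurable_fun setT v -> (forall z, (0 <= v z <= e * k gamma z y)%R) ->
  act t v x <= (e * k (t + gamma) x y)%:E.
Proof.
move=> e0 t0 mv ve; have iflow := pos_integrable_flow K gamma y.
have ieflow := pos_integrableZ e0 iflow.
apply: le_trans (act_le K t x mv (_ : measurable_fun setT (fun z =>
  e * k gamma z y)%R) ve) _.
  by case: ieflow.
rewrite -(evolveE K)// (evolve_lin K t (a := e) (b := 0) ieflow iflow iflow).
  by rewrite mul0r addr0 EFinM (evolveE K)// (act_flow K)// EFinM.
by move=> z; rewrite mul0r addr0.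
Qed.

Lemma measurable_reaction u : curve_measurable u ->
  (forall s z, (0 <= u s z)%R) ->
  curve_measurable (fun s z => f (u s z)).
Proof.
move=> mfu u0; rewrite (_ : (fun s z => f (u s z)) = f_max u);
  first exact: f_max_meas.
by apply/funext => s; apply/funext => z; rewrite /f_max max_r.
Qed.

(** [source_le] compares the source with the kernel, whose mass is at most
    1. *)
Lemma reaction_mass_le (c : R) u y s : (0 <= c)%R -> curve_measurable u ->
  (forall t x, (t < 0)%R -> u t x = 0%R) ->
  (forall t x, (0 <= t)%R -> (0 <= u t x <= c * k (t + gamma) x y)%R) ->
  \int[mu]_z (f (u s z))%:E <= (rate c * gamma `^ (- kappa))%:E.
Proof.
move=> c0 mfu u_past u_le.
have [s0|s0] := leP 0%R s; last first.
  under eq_integral do rewrite u_past// f_at0.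
  by rewrite integral0 lee_fin !mulr_ge0 ?powR_ge0// ltW.
have u0 t z : (0 <= u t z)%R.
  by have [t0|t0] := leP 0%R t; [case/andP: (u_le t z t0)|rewrite u_past].
have mF := measurable_reaction mfu u0.
have D0 : (0 <= rate c * gamma `^ (- kappa))%R.
  by rewrite !mulr_ge0 ?powR_ge0// ltW.
apply: (@le_trans _ _ (\int[mu]_z ((rate c * gamma `^ (- kappa))%:E *
    (k (s + gamma) z y)%:E))); last first.
  rewrite ge0_integralZl//.
  - by rewrite -[leRHS]mule1 lee_wpmul2l ?lee_fin//; exact: (flow_massr K).
  - by apply/measurable_EFinP; exact: (measurable_flow K).
  - by move=> z _; rewrite lee_fin (flow_ge0 K).
apply: ge0_le_integral => //.
- by move=> z _; rewrite lee_fin f_ge0.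
- by apply/measurable_EFinP; exact: (measurable_source s mF).
- apply: emeasurable_funM => //.
  by apply/measurable_EFinP; exact: (measurable_flow K).
move=> z _; rewrite -EFinM lee_fin.
have /andP[_ uz] := u_le s z s0.
have gs : (gamma <= s + gamma)%R by rewrite lerDr.
apply: le_trans (f_incr (u0 s z) uz) _; apply: le_trans (source_le z y c0 gs) _.
rewrite ler_wpM2r ?(flow_ge0 K)// ler_wpM2l ?mulr_ge0 ?powR_ge0 ?(ltW K1_gt0)//.
rewrite !powRN lef_pV2 ?posrE ?powR_gt0 ?ltr_wpDl//.
apply: ge0_ler_powR; rewrite ?nnegrE//.
- exact: ltW (lt_trans ltr01 supercritical).
- exact: ltW.
- by rewrite addr_ge0// ltW.
Qed.

(** The constant C is chosen so that the Duhamel term of the barrier is half of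
    the barrier; the other half is left for the datum. *)
Theorem mild_solution_exists : exists eps C : R, [/\ (0 < eps)%R, (0 < C)%R &
  forall v y, measurable_fun setT v ->
    (forall x, (0 <= v x <= eps * k gamma x y)%R) ->
    exists u, [/\ curve_measurable u,
      forall t x, (t < 0)%R -> u t x = 0%R,
      forall t x, (0 <= t)%R -> (0 <= u t x <= C * k (t + gamma) x y)%R &
      forall t x, (0 <= t)%R ->
        (u t x)%:E = act t v x + duhamel (fun s z => f (u s z)) t x]].
Proof.
have kappa1 : (0 < kappa - 1)%R by rewrite subr_gt0.
pose D : R := (K1 * A `^ (p - 1) * (gamma `^ (1 - kappa) / (kappa - 1)))%R.
have D0 : (0 < D)%R by rewrite !mulr_gt0 ?powR_gt0 ?invr_gt0.
(* c^(p-1) = 1/(2D), which makes the Duhamel term of the barrier c/2 *)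
pose c : R := ((2 * D)^-1 `^ (p - 1)^-1)%R.
have c0 : (0 < c)%R by rewrite powR_gt0// invr_gt0 mulr_gt0.
have rate_c : (rate c * (gamma `^ (1 - kappa) / (kappa - 1)) = c / 2)%R.
  have -> : (rate c * (gamma `^ (1 - kappa) / (kappa - 1)) = c `^ p * D)%R.
    by rewrite /D; ring.
  have -> : (c `^ p = c * c `^ (p - 1))%R.
    rewrite -[X in _ = (X * _)%R](powRr1 (ltW c0)) -powRD 1?addrC ?subrK//.
    by apply/implyP => _; rewrite gt_eqF.
  have p10 : (p - 1 != 0)%R by rewrite subr_eq0 gt_eqF.
  have D2 : (0 <= (2 * D)^-1)%R by rewrite invr_ge0 mulr_ge0// ltW.
  rewrite /c -(powRrM _ _ (p - 1)) mulVf// powRr1//.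
  by rewrite -mulrA invfM mulfVK// gt_eqF.
exists (c / 2)%R, c; split => //; first by rewrite divr_gt0.
move=> v y mv ve.
have v0 x : (0 <= v x)%R by case/andP: (ve x).
pose e t x : R := if (0 <= t)%R then evolve t v x else 0%R.
have e0 t x : (0 <= e t x)%R by rewrite /e; case: ifP => // _;
  exact: (evolve_ge0 K).
have me : curve_measurable e.
  apply: measurable_fun_ifT => //; first exact: measurable_fun_ler.
  exact: (measurable_evolve_curve K).
pose curry (U : R * T -> R) : R -> T -> R := fun t x => U (t, x).
pose Phi (U : R * T -> R) (q : R * T) : \bar R :=
  (e q.1 q.2)%:E + duhamel (f_max (curry U)) q.1 q.2.
have mcurry U : measurable_fun setT U -> curve_measurable (curry U).
  move=> mU; rewrite /curve_measurable /curry.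
  by apply: (measurableT_comp mU); apply: measurable_fun_pair.
have mfm U : measurable_fun setT U -> curve_measurable (f_max (curry U)).
  by move=> mU; apply: f_max_meas; exact: mcurry.
have [||||||U [mU U_le UE]] := @fixpoint_below_supersolution _ (R * T)%type R
  Phi (fun q => barrier c y q.1 q.2).
- by move=> U q; apply: adde_ge0; [rewrite lee_fin|apply: (duhamel_ge0 K);
    exact: f_max_ge0].
- move=> U mU; apply: emeasurable_funD; first exact/measurable_EFinP.
  by apply: (measurable_duhamel K); [exact: mfm|exact: f_max_ge0].
- move=> U V mU mV UV q; apply: leeD => //; apply: (duhamel_homo K) => //.
  + exact: mfm.
  + exact: mfm.
  + move=> s z; apply: f_incr; first by rewrite le_max lexx.
    by rewrite ge_max !le_max lexx/= /curry UV orbT.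
- move=> U_ U mU_ mU U_nd U_cvg q; apply: cvgeD.
  + by rewrite ge0_adde_def// inE ?lee_fin//; apply: (duhamel_ge0 K);
      exact: f_max_ge0.
  + exact: cvg_cst.
  apply: (duhamel_cvg K) => //.
  + by move=> n; exact: mfm.
  + exact: mfm.
  + move=> s z a b ab; apply: f_incr; first by rewrite le_max lexx.
    by rewrite ge_max !le_max lexx/= /curry (U_nd (s, z) _ _ ab) orbT.
  + move=> s z.
    by apply: (@cvg_comp _ _ _ (fun n => U_ n (s, z)) (fun v : R =>
      f (Num.max 0%R v)) _ (nbhs (U (s, z))));
      [exact: U_cvg|exact: continuous_f_max].
- exact: barrier_meas.
- move=> [t x]; rewrite /Phi/=.
  rewrite (_ : curry _ = barrier c y)//.
  have [t0|t0] := leP 0%R t; last first.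
    rewrite /e /barrier (leNgt 0%R t) t0/= add0e /duhamel.
    rewrite integral0_eq// => s _; apply: integral0_eq => z _.
    have [ts|st] := leP t s; first by rewrite (flow_le0 K) ?mul0r// subr_le0.
    by rewrite /f_max /barrier leNgt (lt_trans st t0)/= maxxx f_at0 mulr0.
  have -> : barrier c y t x = (c / 2 * k (t + gamma)
    x y + c / 2 * k (t + gamma) x y)%R.
    by rewrite /barrier t0; lra.
  rewrite EFinD; apply: leeD.
    rewrite /e t0 (evolveE K); last first.
      apply: pos_integrable_le (pos_integrableZ _ (pos_integrable_flow K gamma
        y)) => //.
      by rewrite ltW// divr_gt0.
    by apply: evolve_datum_le => //; rewrite ltW// divr_gt0.
  rewrite -rate_c; apply: duhamel_barrier_le => //; exact: ltW.
exists (curry U).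
have U_f : (fun s z => f (curry U s z)) = f_max (curry U).
  apply/funext => s; apply/funext => z; rewrite /f_max max_r//.
  by case/andP: (U_le (s, z)).
split.
- exact: mcurry.
- move=> t x t0; apply/eqP; rewrite eq_le.
  by have := U_le (t, x); rewrite /= /barrier (leNgt 0%R t) t0/= andbC.
- by move=> t x t0; have := U_le (t, x); rewrite /= /barrier t0.
- move=> t x t0; rewrite U_f /curry UE /Phi/= /e t0 (evolveE K)//.
  apply: pos_integrable_le (pos_integrableZ _ (pos_integrable_flow K gamma y))
    => //.
  by rewrite ltW// divr_gt0.
Qed.

End mild_solution.

(** * L1 continuity of mild solutions *)

Section mild_curve_continuity.
Local Open Scope ereal_scope.
Context d (T : measurableType d) (R : realType).
Variable mu : {sigma_finite_measure set T -> \bar R}.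
Variable k : R -> T -> T -> R.
Hypothesis K : sub_markov_flow mu k.
Implicit Types (t s : R) (x y z : T) (u v w : T -> R) (F : R -> T -> R).

Local Notation evolve := (evolve mu k).
Local Notation act := (act mu k).
Local Notation pos_integrable := (pos_integrable mu).
Local Notation duhamel := (duhamel mu k).
Local Notation L1dist := (L1dist mu).

Let lam : {sigma_finite_measure set (measurableTypeR R) -> \bar R} :=
  @lebesgue_measure R.

Definition source_before (a : R) F : R -> T -> R := fun s z =>
  if (s < a)%R then F s z else 0%R.
Definition source_from (a : R) F : R -> T -> R := fun s z =>
  if (a <= s)%R then F s z else 0%R.

Lemma measurable_source_before a F : curve_measurable F ->
  curve_measurable (source_before a F).
Proof.
by move=> mF; apply: measurable_fun_ifT => //; exact: measurable_fun_ltr.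
Qed.

Lemma measurable_source_from a F : curve_measurable F ->
  curve_measurable (source_from a F).
Proof.
by move=> mF; apply: measurable_fun_ifT => //; exact: measurable_fun_ler.
Qed.

Lemma source_before_ge0 a F : (forall s z, 0 <= F s z)%R ->
  forall s z, (0 <= source_before a F s z)%R.
Proof. by move=> F0 s z; rewrite /source_before; case: ifP. Qed.

Lemma source_from_ge0 a F : (forall s z, 0 <= F s z)%R ->
  forall s z, (0 <= source_from a F s z)%R.
Proof. by move=> F0 s z; rewrite /source_from; case: ifP. Qed.

Lemma measurable_flowM t x w : measurable_fun setT w ->
  measurable_fun setT (fun z => (k t x z * w z)%:E).
Proof.
move=> mw; apply/measurable_EFinP; apply: measurable_funM => //.
exact: (measurable_flow K).
Qed.

Lemma flowM_ge0 t x w z : (0 <= w z)%R -> 0 <= (k t x z * w z)%:E.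
Proof. by move=> w0; rewrite lee_fin mulr_ge0// (flow_ge0 K). Qed.

(** Cutting the source at time a separates what the solution has already felt
    at time a from the remainder. *)
Lemma duhamel_split a F t x : curve_measurable F ->
  (forall s z, 0 <= F s z)%R ->
  duhamel F t x = duhamel (source_before a F) t x + duhamel (source_from a F)
    t x.
Proof.
move=> mF F0; have b0 := source_before_ge0 a F0;
  have f0 := source_from_ge0 a F0.
have mb := measurable_source_before a mF;
  have mf := measurable_source_from a mF.
rewrite /duhamel -ge0_integralD//.
- apply: eq_integral => s _; rewrite -ge0_integralD//.
  + apply: eq_integral => z _;
      rewrite -EFinD -mulrDr /source_before /source_from.
    by have [sa|sa] := ltP s a; rewrite ?addr0 ?add0r.
  + by move=> z _; exact: flowM_ge0.
  + by apply: measurable_flowM; exact: measurable_source.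
  + by move=> z _; exact: flowM_ge0.
  + by apply: measurable_flowM; exact: measurable_source.
- by move=> s _; exact: flow_source_ge0.
- exact: (measurable_flow_source K).
- by move=> s _; exact: flow_source_ge0.
- exact: (measurable_flow_source K).
Qed.

Lemma measurable_flow_source2 F t : curve_measurable F ->
  (forall s z, 0 <= F s z)%R ->
  measurable_fun [set: (T * measurableTypeR R)%type]
    (fun q => \int[mu]_z (k (t - q.2) q.1 z * F q.2 z)%:E).
Proof.
move=> mF F0.
apply: (@measurable_integral_flow _ _ _ mu k K _ (T * measurableTypeR R)%type
    (fun q => t - q.2)%R (fun q => q.1) (fun q => F q.2)) => //.
- by apply: measurable_funB.
- exact: measurable_fst.
- have mg : measurable_fun [set: ((T * measurableTypeR R) * T)%type]
      (fun q => (q.1.2 : measurableTypeR R, q.2)).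
    by apply: measurable_fun_pair => //; exact: measurableT_comp.
  exact: (measurableT_comp mF mg).
Qed.

Lemma pos_integrable_source F (c : R) s : curve_measurable F ->
  (forall s z, 0 <= F s z)%R -> (forall s, \int[mu]_z (F s z)%:E <= c%:E) ->
  pos_integrable (F s).
Proof.
move=> mF F0 Fc; split; [exact: measurable_source|exact: F0|].
exact: le_lt_trans (Fc s) (ltry _).
Qed.

(** P_(b-s) does not increase the integral, and only the sources emitted during
    [a, b] contribute. *)
Lemma integral_duhamel_le F (c a b : R) : (0 <= c)%R -> (a <= b)%R ->
  curve_measurable F -> (forall s z, 0 <= F s z)%R ->
  (forall s, \int[mu]_z (F s z)%:E <= c%:E) ->
  \int[mu]_x duhamel (source_from a F) b x <= (c * (b - a))%:E.
Proof.
move=> c0 ab mF F0 Fc; have f0 := source_from_ge0 a F0;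
  have mf := measurable_source_from a mF.
rewrite /duhamel (sfinite_Fubini mu lam
  (fun q : T * measurableTypeR R =>
    \int[mu]_z (k (b - q.2) q.1 z * source_from a F q.2 z)%:E))//=;
  last 2 first.
- by move=> q; exact: flow_source_ge0.
- exact: measurable_flow_source2.
apply: (@le_trans _ _ (\int[lam]_(s in `[a, b]) (cst c%:E s))); last first.
  rewrite integral_cst//= lebesgue_measure_itv/= lte_fin EFinM.
  rewrite lee_wpmul2l ?lee_fin//.
  by case: ifPn => // _; rewrite lee_fin subr_ge0.
rewrite [leRHS]integral_mkcond; apply: ge0_le_integral => //.
- by move=> s _; apply: integral_ge0 => x _; exact: flow_source_ge0.
- apply: (measurable_fun_fubini_tonelli_G (m1 := mu)
    (fun q : T * measurableTypeR R =>
      \int[mu]_z (k (b - q.2) q.1 z * source_from a F q.2 z)%:E)).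
    exact: measurable_flow_source2.
  by move=> q; exact: flow_source_ge0.
- by apply/(measurable_restrictT _ _).1.
move=> s _; rewrite patchE.
case: ifPn => [|/negP nst]; last first.
  rewrite le_eqVlt; apply/orP; left; apply/eqP; apply: integral0_eq => x _.
  apply: integral0_eq => z _.
  rewrite /source_from; have [sa|sa] := leP a s; last by rewrite mulr0.
  rewrite (flow_le0 K) ?mul0r// leNgt subr_gt0; apply/negP => st; apply: nst.
  by rewrite inE/= in_itv/= sa ltW.
rewrite inE/= in_itv/= => /andP[sa].
rewrite le_eqVlt => /predU1P[->|st].
  rewrite integral0_eq//= => x _; apply: integral0_eq => z _.
  by rewrite (flow_le0 K) ?mul0r// subrr.
have iF := pos_integrable_source s mF F0 Fc.
apply: le_trans (Fc s); apply: le_trans (integral_act_le K (b - s) iF).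
by rewrite /act gt_eqF ?subr_gt0// /source_from sa.
Qed.

(** P_t moves under the Duhamel integral by Tonelli and composes there with
    P_(a-s). *)
Lemma act_duhamel F a t x : (0 < t)%R -> curve_measurable F ->
  (forall s, pos_integrable (F s)) ->
  \int[mu]_z ((k t x z)%:E * duhamel F a z) = duhamel (source_before a F)
    (t + a) x.
Proof.
move=> t0 mF iF; have F0 s z : (0 <= F s z)%R by case: (iF s).
transitivity (\int[mu]_z \int[lam]_s
   ((k t x z)%:E * \int[mu]_w (k (a - s) z w * F s w)%:E)).
  apply: eq_integral => z _; rewrite -ge0_integralZl//.
  - exact: (measurable_flow_source K).
  - by move=> s _; exact: flow_source_ge0.
  - by rewrite lee_fin (flow_ge0 K).
rewrite (sfinite_Fubini mu lam (fun q : T * measurableTypeR R =>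
   (k t x q.1)%:E * \int[mu]_w (k (a - q.2) q.1 w * F q.2 w)%:E))//=;
     last 2 first.
- move=> q; apply: mule_ge0; first by rewrite lee_fin (flow_ge0 K).
  exact: flow_source_ge0.
- apply: emeasurable_funM.
    by apply/measurable_EFinP; apply: (measurable_flow K) => //.
  exact: measurable_flow_source2.
apply: eq_integral => s _; rewrite /source_before.
have [sa|sa] := ltP s a; last first.
  rewrite !integral0_eq// => z _; rewrite ?mulr0//.
  by rewrite integral0_eq ?mule0// => w _;
    rewrite (flow_le0 K) ?mul0r// subr_le0.
have as0 : (0 < a - s)%R by rewrite subr_gt0.
have := evolveD K (ltW t0) (ltW as0) (iF s).
move=> /(congr1 (fun g => (g x)%:E)); rewrite !(evolveE K)//; last first.
  exact: pos_integrable_evolve.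
rewrite /act (gt_eqF t0) (gt_eqF (addr_gt0 t0 as0)) addrA => <-.
by apply: eq_integral => z _; rewrite EFinM (evolveE K)// /act gt_eqF.
Qed.

Variables (v : T -> R) (F : R -> T -> R) (u : R -> T -> R) (c : R).
Hypothesis iv : pos_integrable v.
Hypothesis mF : curve_measurable F.
Hypothesis F0 : forall s z, (0 <= F s z)%R.
Hypothesis c0 : (0 <= c)%R.
Hypothesis Fc : forall s, \int[mu]_z (F s z)%:E <= c%:E.
Hypothesis iu : forall t, (0 <= t)%R -> pos_integrable (u t).
Hypothesis mild : forall t x, (0 <= t)%R ->
  (u t x)%:E = act t v x + duhamel F t x.
Hypothesis continuous_start : forall w, pos_integrable w ->
  continuous_at_start mu k w.

(** The equation restarted at time a, with datum u(a): the cocycle property of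
    mild solutions. *)
Lemma mild_restart a b x : (0 <= a)%R -> (a <= b)%R ->
  (u b x)%:E = (evolve (b - a) (u a) x)%:E + duhamel (source_from a F) b x.
Proof.
move=> a0 ab; have iF s := pos_integrable_source s mF F0 Fc.
rewrite mild; last exact: le_trans ab.
rewrite (duhamel_split a)// addeA; congr (_ + _).
move: ab; rewrite le_eqVlt => /predU1P[ab|ab].
  rewrite -ab subrr evolve0 (mild _ a0); congr (_ + _).
  rewrite [RHS](duhamel_split a)// [X in _ = _ + X]integral0_eq ?adde0// => s _.
  apply: integral0_eq => z _; rewrite /source_from.
  by have [sa|sa] := leP a s; rewrite ?mulr0// (flow_le0 K) ?mul0r// subr_le0.
have ba : (0 < b - a)%R by rewrite subr_gt0.
have iua := iu a0.
rewrite (evolveE K)//.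
rewrite {2}/act (gt_eqF ba).
have mact := measurable_act K a (v := v).
transitivity (\int[mu]_z ((k (b - a) x z)%:E * act a v z
                        + (k (b - a) x z)%:E * duhamel F a z)); last first.
  apply: eq_integral => z _; rewrite EFinM mild//.
  apply/esym/ge0_muleDr; last exact: (duhamel_ge0 K).
  by apply: (act_ge0 K); case: iv.
have mk : measurable_fun setT (fun z => (k (b - a) x z)%:E).
  by apply/measurable_EFinP; exact: (measurable_flow K).
have [mv v0 _] := iv.
rewrite ge0_integralD//; last first.
- apply: emeasurable_funM => //.
  exact: (measurableT_comp (measurable_duhamel K mF F0)
    (measurable_fun_pair (measurable_cst a) (@measurable_id _ _ _))).
- by move=> z _; rewrite mule_ge0 ?lee_fin ?(flow_ge0 K)// (duhamel_ge0 K).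
- by apply: emeasurable_funM => //; exact: mact.
- by move=> z _; rewrite mule_ge0 ?lee_fin ?(flow_ge0 K)// (act_ge0 K).
rewrite (act_duhamel _ _ ba mF iF) subrK; congr (_ + _).
rewrite -[b in LHS](subrK a) -(evolveE K)// -(evolveD K (ltW ba) a0 iv)
  (evolveE K).
  rewrite /act (gt_eqF ba); apply: eq_integral => z _.
  by rewrite EFinM (evolveE K).
exact: pos_integrable_evolve.
Qed.

Lemma mild_restart_dist a b : (0 <= a)%R -> (a <= b)%R ->
  L1dist (u b) (evolve (b - a) (u a)) <= (c * (b - a))%:E.
Proof.
move=> a0 ab; apply: le_trans (integral_duhamel_le c0 ab mF F0 Fc).
have [mub _ _] := iu (le_trans a0 ab).
have [mea _ _] := pos_integrable_evolve K (b - a) (iu a0).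
apply: ge0_le_integral => //.
- exact/measurable_EFinP/measurable_absB.
- exact: (measurableT_comp (measurable_duhamel K (measurable_source_from a mF)
    (source_from_ge0 a F0))
    (measurable_fun_pair (measurable_cst b) (@measurable_id _ _ _))).
move=> x _; have := mild_restart x a0 ab.
set D := duhamel _ _ _ => uE.
have D0 : 0 <= D by apply: (duhamel_ge0 K); exact: source_from_ge0.
case: D D0 uE => [r||//]; last by rewrite leey.
by rewrite !lee_fin => r0 [->]; rewrite addrAC subrr add0r ger0_norm.
Qed.

(** Continuity from both sides at once.  With a restart time a just below t,
    both u(s) and u(t) are within c (2 r1) of P_(s-a) u(a) and P_(t-a) u(a),
    and by contractivity these differ by at most the distance from P_|s-t| u(a)
    to u(a). *)
Theorem mild_L1_continuous t : (0 <= t)%R -> forall e : R, (0 < e)%R ->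
  exists2 r : R, (0 < r)%R & forall s, (0 <= s)%R -> (`|s - t| < r)%R ->
    L1dist (u s) (u t) <= e%:E.
Proof.
move=> t0 e e0.
(* restart slightly before t, so that s and t lie after the restart *)
pose r1 : R := (e / (6 * (c + 1)))%R.
have c1 : (0 < c + 1)%R by rewrite ltr_wpDl.
have r10 : (0 < r1)%R by rewrite divr_gt0// mulr_gt0.
pose a : R := (Num.max 0 (t - r1))%R.
have a0 : (0 <= a)%R by rewrite le_max lexx.
have at_ : (a <= t)%R by rewrite ge_max t0/= gerBl ltW.
have tar : (t - a <= r1)%R by rewrite lerBlDr -lerBlDl le_max lexx orbT.
have e3 : (0 < e / 3)%R by rewrite divr_gt0.
have [r2 r20 hr2] := continuous_start (iu a0) e3.
exists (Num.min r1 r2); first by rewrite lt_min r10.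
suff main b b' : (a <= b)%R -> (b <= b')%R -> (b' - b < r2)%R ->
    (b' - a <= 2 * r1)%R ->
    L1dist (u b) (u b') <= e%:E.
  move=> s s0; rewrite lt_min => /andP[str1 str2].
  have as_ : (a <= s)%R.
    by rewrite ge_max s0/=; move: str1; rewrite ltr_norml => /andP[? _]; lra.
  have [st|ts] := leP s t.
    apply: main => //; last lra.
    by move: str2; rewrite distrC ger0_norm// subr_ge0.
  rewrite L1distC; apply: main => //; first exact: ltW.
    by move: str2; rewrite ger0_norm// subr_ge0 ltW.
  move: str1; rewrite ltr_norml => /andP[_ ?]; lra.
move=> ab bb' b'b b'a; have ab' : (a <= b')%R by exact: le_trans bb'.
have ba : (b - a <= 2 * r1)%R by apply: le_trans b'a; rewrite lerB.
have mu_ s : (0 <= s)%R -> measurable_fun setT (u s) by move=> /iu[].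
have iea s := pos_integrable_evolve K s (iu a0).
have mea s : measurable_fun setT (evolve s (u a)) by case: (iea s).
have small s : (a <= s)%R -> (s - a <= 2 * r1)%R ->
    L1dist (u s) (evolve (s - a) (u a)) <= (e / 3)%:E.
  move=> as_ sa; apply: (le_trans (mild_restart_dist a0 as_)).
  rewrite lee_fin; apply: (@le_trans _ _ (c * (2 * r1))%R).
    by rewrite ler_wpM2l.
  rewrite /r1 (_ : c * _ = e / 3 * (c / (c + 1)))%R; last by field;
    rewrite gt_eqF.
  by rewrite ler_piMr ?(ltW e3)// ler_pdivrMr// mul1r lerDl.
have -> : e%:E = (e / 3)%:E + ((e / 3)%:E + (e / 3)%:E).
  by rewrite -!EFinD; congr EFin; field.
apply: (le_trans (L1dist_triangle (v := evolve (b - a) (u a)) _ _ _ _)) => //.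
- exact/mu_/(le_trans a0).
- exact/mu_/(le_trans a0).
apply: leeD; first exact: small.
apply: (le_trans (L1dist_triangle (v := evolve (b' - a) (u a)) _ _ _ _)) => //.
- exact/mu_/(le_trans a0).
apply: leeD; last by rewrite L1distC; exact: small.
have -> : (b' - a = (b - a) + (b' - b))%R by ring.
have ba0 : (0 <= b - a)%R by rewrite subr_ge0.
have bb0 : (0 <= b' - b)%R by rewrite subr_ge0.
rewrite -(evolveD K ba0 bb0 (iu a0)).
apply: (le_trans (L1dist_evolve K _ (iu a0) (iea _))).
by rewrite L1distC; apply: hr2; rewrite bb0.
Qed.

End mild_curve_continuity.

(** * From L1 to Lq for bounded functions *)

Section bounded_Lq.
Local Open Scope ereal_scope.
Context d (T : measurableType d) (R : realType).
Variable mu : {sigma_finite_measure set T -> \bar R}.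
Local Notation L1dist := (L1dist mu).
Local Notation pos_integrable := (pos_integrable mu).

(** From |g|^q = |g|^(q-1) |g| <= B^(q-1) |g|. *)
Lemma Lnorm_bounded_le (q B : R) (g : T -> R) : (1 <= q)%R ->
  measurable_fun setT g -> (forall x, `|g x| <= B)%R ->
  'N[mu]_(q%:E)[EFin \o g] <=
    ((B `^ (q - 1))%:E * \int[mu]_x (`|g x|)%:E) `^ q^-1.
Proof.
move=> q1 mg gB; rewrite unlock.
have mag : measurable_fun setT (fun x => `|g x|)%R by exact: measurableT_comp.
have absE x : `|(g x)%:E| `^ q = (`|g x|%R `^ q)%:E by rewrite abse_EFin
  poweR_EFin.
have le : \int[mu]_x `|(g x)%:E| `^ q <= (B `^ (q - 1))%:E * \int[mu]_x (`|g
  x|)%:E.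
  rewrite -ge0_integralZl//; last 2 first.
  - exact/measurable_EFinP.
  - by rewrite lee_fin powR_ge0.
  apply: ge0_le_integral => //.
  - by move=> x _; exact: poweR_ge0.
  - under eq_fun do rewrite absE.
    apply/measurable_EFinP.
    exact: (measurableT_comp (measurable_powR q) mag).
  - by apply: emeasurable_funM => //; exact/measurable_EFinP.
  move=> x _; rewrite absE -EFinM lee_fin.
  have -> : (`|g x| `^ q = `|g x| `^ (q - 1) * `|g x|)%R.
    rewrite -[X in _ = (_ * X)%R](powRr1 (normr_ge0 (g x))).
    have [->|gx0] := eqVneq `|g x|%R 0%R.
      rewrite [(0 `^ 1)%R]powR0 ?oner_neq0// mulr0 powR0//.
      by rewrite gt_eqF// (lt_le_trans ltr01).
    rewrite -powRD ?subrK//; by apply/implyP.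
  rewrite ler_wpM2r//; apply: ge0_ler_powR; rewrite ?nnegrE ?subr_ge0//.
  exact: le_trans (gB x).
apply: gt0_ler_poweR => //.
- by rewrite invr_ge0 (le_trans ler01).
- rewrite in_itv/= leey andbT; apply: integral_ge0 => x _;
    by rewrite lee_fin powR_ge0.
- rewrite in_itv/= leey andbT; apply: mule_ge0;
    first by rewrite lee_fin powR_ge0.
  by apply: integral_ge0 => x _; rewrite lee_fin.
Qed.

Lemma bounded_pos_integrable_Lfun (q B : R) (v : T -> R) : (1 <= q)%R ->
  pos_integrable v -> (forall x, v x <= B)%R -> v \in Lfun mu q%:E.
Proof.
move=> q1 [mv v0 vi] vB; rewrite inE/=; apply/andP; split; rewrite inE//=.
have absv x : (`|v x| = v x)%R by rewrite ger0_norm.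
apply: le_lt_trans (Lnorm_bounded_le (B := B) q1 mv _) _.
  by move=> x; rewrite absv.
apply: poweR_lty; under eq_integral do rewrite absv.
by rewrite lte_mul_pinfty// lee_fin powR_ge0.
Qed.

Lemma L1_continuous_Lq (q B : R) (u : R -> T -> R) (t : R) : (1 <= q)%R ->
  (0 <= t)%R ->
  (forall s, (0 <= s)%R -> pos_integrable (u s)) ->
  (forall s x, (0 <= s)%R -> (u s x <= B)%R) ->
  (forall e : R, (0 < e)%R -> exists2 r : R, (0 < r)%R &
    forall s, (0 <= s)%R -> (`|s - t| < r)%R -> L1dist (u s) (u t) <= e%:E) ->
  'N[mu]_(q%:E)[EFin \o (u s \- u t)%R] @[s --> within `[0%R, +oo[ (nbhs t)]
    --> 0.
Proof.
move=> q1 t0 iu uB cu.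
have q0 : q != 0%R by rewrite gt_eqF// (lt_le_trans ltr01).
have u0 s x : (0 <= s)%R -> (0 <= u s x)%R by move=> /iu[].
have near_le (e : R) : (0 < e)%R -> \forall s \near within `[0%R, +oo[ (nbhs t),
    'N[mu]_(q%:E)[EFin \o (u s \- u t)%R] <= e%:E.
  move=> e0; pose D : R := ((B `^ (q - 1)) + 1)%R.
  have D0 : (0 < D)%R by rewrite ltr_wpDl ?powR_ge0.
  have e'0 : (0 < e `^ q / D)%R by rewrite divr_gt0 ?powR_gt0.
  have [r r0 hr] := cu _ e'0.
  rewrite near_withinE; near=> s; rewrite /= in_itv/= andbT => s0.
  have mus : measurable_fun setT (u s) by case: (iu _ s0).
  have mut : measurable_fun setT (u t) by case: (iu _ t0).
  apply: le_trans (Lnorm_bounded_le (B := B) q1 _ _) _.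
  - exact: measurable_funB.
  - move=> x /=; rewrite ler_norml; apply/andP; split.
      by rewrite lerNl opprB (le_trans _ (uB t x t0))// gerBl u0.
    by rewrite (le_trans _ (uB s x s0))// gerBl u0.
  have -> : e%:E = ((e `^ q)%:E) `^ q^-1.
    by rewrite poweR_EFin -powRrM mulfV// powRr1// ltW.
  apply: gt0_ler_poweR => //.
  - by rewrite invr_ge0 (le_trans ler01).
  - rewrite in_itv/= leey andbT; apply: mule_ge0;
      first by rewrite lee_fin powR_ge0.
    by apply: integral_ge0 => x _; rewrite lee_fin.
  - by rewrite in_itv/= leey andbT lee_fin powR_ge0.
  apply: (@le_trans _ _ ((B `^ (q - 1))%:E * (e `^ q / D)%:E)).
    rewrite lee_wpmul2l ?lee_fin ?powR_ge0//; apply: hr => //.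
  rewrite -EFinM lee_fin mulrCA ler_piMr ?powR_ge0//.
  by rewrite ler_pdivrMr// mul1r lerDl.
apply/fine_cvgP; split.
  have := near_le 1%R ltr01; apply: filterS => s s1.
  by rewrite ge0_fin_numE ?Lnorm_ge0// (le_lt_trans s1) ?ltry.
apply/cvgrPdist_le => e e0; have := near_le e e0; apply: filterS => s /= se.
rewrite sub0r normrN ger0_norm ?fine_ge0 ?Lnorm_ge0//.
rewrite -lee_fin fineK// ge0_fin_numE ?Lnorm_ge0// (le_lt_trans se) ?ltry//.
Unshelve. all: by end_near. Qed.

End bounded_Lq.

(** * Global solutions for sub-Markov kernels *)

Section global_solutions.
Local Open Scope ereal_scope.
Context d (T : measurableType d) (R : realType).
Variable mu : {sigma_finite_measure set T -> \bar R}.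
Variable k : R -> T -> T -> R.
Hypothesis K : sub_markov_flow mu k.
Hypothesis continuous_start : forall w, pos_integrable mu w ->
  continuous_at_start mu k w.
Variables (gamma A alpha p K1 : R) (f : R -> R).
Hypothesis gamma_gt0 : (0 < gamma)%R.
Hypothesis A_gt0 : (0 < A)%R.
Hypothesis decay : forall (t : R) x y, (gamma <= t)%R ->
  (k t x y <= A * t `^ (- alpha))%R.
Hypothesis p_gt1 : (1 < p)%R.
Hypothesis supercritical : (1 < alpha * (p - 1))%R.
Hypothesis f_ge0 : forall v : R, (0 <= v -> 0 <= f v)%R.
Hypothesis f_cont : {within `[0%R, +oo[, continuous f}.
Hypothesis f_incr : forall v w : R, (0 <= v -> v <= w -> f v <= f w)%R.
Hypothesis K1_gt0 : (0 < K1)%R.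
Hypothesis f_le : forall v : R, (0 <= v -> f v <= K1 * v `^ p)%R.

Local Notation act := (act mu k).
Local Notation pos_integrable := (pos_integrable mu).

(** The constants depend neither on y nor on q: the Lq continuity is a
    consequence of the L^1 theory and of boundedness, whatever q. *)
Theorem global_solution_exists : exists eps C : R, [/\ (0 < eps)%R, (0 < C)%R &
  forall (q : R) (v : T -> R) (y : T), (1 <= q)%R -> measurable_fun setT v ->
    (forall x, (0 <= v x <= eps * k gamma x y)%R) ->
    exists u : R -> T -> R, [/\
      (forall t, (0 <= t)%R -> u t \in Lfun mu q%:E) /\
      (forall t, (0 <= t)%R -> 'N[mu]_(q%:E)[EFin \o (u s \- u t)%R]
         @[s --> within `[0%R, +oo[ (nbhs t)] --> 0),
      forall t x, (0 <= t)%R -> (0 <= u t x <= C * k (t + gamma) x y)%R,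
      forall s, pos_integrable (fun z => f (u s z)) &
      forall t x, (0 <= t)%R ->
        (@lebesgue_measure R).-integrable `[0%R, t]
          (fun s => act (t - s) (f \o u s) x) /\
        (u t x)%:E = act t v x + \int[@lebesgue_measure R]_(s in `[0%R, t])
          act (t - s) (f \o u s) x]].
Proof.
have [eps [C [eps0 C0 sol]]] := mild_solution_exists K gamma_gt0 A_gt0 decay
  p_gt1
  supercritical f_ge0 f_cont f_incr K1_gt0 f_le.
exists eps, C; split => // q v y q1 mv ve.
have [u [mfu u_past u_le u_mild]] := sol v y mv ve.
have u0 t x : (0 <= u t x)%R.
  by have [t0|t0] := leP 0%R t; [case/andP: (u_le t x t0)|rewrite u_past].
pose F s z := f (u s z).
have mF : curve_measurable F by exact: (measurable_reaction f_cont).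
have F0 s z : (0 <= F s z)%R by exact: f_ge0.
have F_past s z : (s < 0)%R -> F s z = 0%R.
  by move=> s0; rewrite /F u_past// (f_at0 p_gt1 f_ge0 f_le).
set c : R := (K1 * C `^ p * A `^ (p - 1) * gamma `^ (- (alpha * (p - 1))))%R.
have c0 : (0 <= c)%R by rewrite !mulr_ge0 ?powR_ge0// ltW.
have Fc s : \int[mu]_z (F s z)%:E <= c%:E.
  exact: (reaction_mass_le K gamma_gt0 A_gt0 decay p_gt1 supercritical f_ge0
    f_cont
    f_incr K1_gt0 f_le s (ltW C0) mfu u_past u_le).
have iF s : pos_integrable (F s) by exact: pos_integrable_source mF F0 Fc.
have iu t : (0 <= t)%R -> pos_integrable (u t).
  move=> t0; apply: pos_integrable_le
    (pos_integrableZ (ltW C0) (pos_integrable_flow K (t + gamma) y)).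
    exact: measurable_source.
  by move=> x; exact: u_le.
have iv : pos_integrable v.
  by apply: pos_integrable_le
    (pos_integrableZ (ltW eps0) (pos_integrable_flow K gamma y)).
pose B : R := (C * (A * gamma `^ (- alpha)))%R.
have alpha0 : (0 <= alpha)%R.
  have := lt_trans ltr01 supercritical; rewrite pmulr_lgt0 ?subr_gt0//;
    exact: ltW.
have uB s x : (0 <= s)%R -> (u s x <= B)%R.
  move=> s0; have /andP[_ le] := u_le s x s0; apply: le_trans le _.
  rewrite ler_wpM2l ?(ltW C0)//.
  have gs : (gamma <= s + gamma)%R by rewrite lerDr.
  apply: le_trans (decay _ _ gs) _; rewrite ler_wpM2l ?(ltW A_gt0)//.
  rewrite !powRN lef_pV2 ?posrE ?powR_gt0 ?ltr_wpDl//.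
  by apply: ge0_ler_powR; rewrite ?nnegrE// ?addr_ge0// ltW.
have u_cont := mild_L1_continuous K iv mF F0 c0 Fc iu u_mild continuous_start.
exists u; split.
- split=> t t0.
    by apply: (bounded_pos_integrable_Lfun (B := B)) => // [|x];
      [exact: iu|exact: uB].
  by apply: (L1_continuous_Lq (B := B)) => //; exact: u_cont.
- exact: u_le.
- exact: iF.
move=> t x t0; have [mact intE] := duhamel_act K x t0 mF F0 F_past.
split; last by rewrite u_mild// -intE.
apply/integrableP; split => //.
have absE (s : R) : `|act (t - s) (f \o u s) x| = act (t - s) (F s) x.
  by rewrite gee0_abs//; apply: (act_ge0 K) => z; exact: F0.
under eq_integral do rewrite absE.
rewrite intE; apply: (@le_lt_trans _ _ (u t x)%:E); last exact: ltry.
by rewrite u_mild// leeDr//; apply: (act_ge0 K); case: iv.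
Qed.

End global_solutions.

(** * Open sets of products with countable bases *)

Section countable_basis.

(** The class m stands for a sigma-algebra on a type whose topology lives on a
    convertible but different carrier. *)
Definition countable_basis_in (X : topologicalType) (m : set (set X)) : Prop :=
  exists B : set (set X), [/\ countable B, basis B & B `<=` m].

(** An open set is the union of the basic sets that it contains, which can be
    enumerated through an injection of the basis into nat. *)
Lemma countable_basis_open (X : topologicalType) (m : set (set X)) (A : set X) :
  m set0 ->
  (forall F : (set X)^nat, (forall n, m (F n)) -> m (\bigcup_n F n)) ->
  countable_basis_in m -> open A -> m A.
Proof.
move=> m0 mU [B [/countable_injP[i inj_i] [oB nB] Bm]] oA.
pose F n : set X := [set x | exists U, [/\ B U, U `<=` A, i U = n & U x]].
have -> : A = \bigcup_n F n.
  apply/seteqP; split => [x Ax|x [n _ [U [_ UA _ Ux]]]]; last exact: UA.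
  have [U [BU Ux] UA] := nB x A (open_nbhs_nbhs (conj oA Ax)).
  by exists (i U) => //; exists U.
apply: mU => n.
have [[U [BU UA iU]]|none] := pselect (exists U, [/\ B U, U `<=` A & i U = n]).
  suff -> : F n = U by exact: Bm.
  apply/seteqP; split => [x [V [BV _ iV Vx]]|x Ux]; last by exists U.
  suff <- : V = U by [].
  by apply: inj_i; rewrite ?inE// iV.
suff -> : F n = set0 by [].
apply/seteqP; split => // x [U [BU UA iU _]].
by apply: none; exists U.
Qed.

Lemma countable_basis_prod (X Y : topologicalType) (mX : set (set X))
    (mY : set (set Y)) (mXY : set (set (X * Y))) :
  (forall A B, mX A -> mY B -> mXY (A `*` B)) ->
  countable_basis_in mX -> countable_basis_in mY -> countable_basis_in mXY.
Proof.
move=> mprod [BX [cX [oX nX] sX]] [BY [cY [oY nY] sY]].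
exists [set U.1 `*` U.2 | U in BX `*` BY]; split.
- exact: card_le_trans (card_image_le _ _) (countableX cX cY).
- split.
    move=> _ [[U V] [/= BU BV] <-]; rewrite openE => -[x y] [/= Ux Vy].
    by exists (U, V) => //; split; apply: open_nbhs_nbhs; split => //;
      [exact: oX|exact: oY].
  move=> [x y] A [[A1 A2] /= [nA1 nA2] A12].
  have [U [BU Ux] UA] := nX x _ nA1; have [V [BV Vy] VA] := nY y _ nA2.
  exists (U `*` V); first by split => //; exists (U, V).
  by move=> [a b] [/= Ua Vb]; apply: A12; split; [exact: UA|exact: VA].
- by move=> _ [[U V] [/= BU BV] <-]; apply: mprod; [exact: sX|exact: sY].
Qed.

Lemma countable_basis_real (R : realType) :
  countable_basis_in (@open R).
Proof.
exists [set `]ratr q.1, ratr q.2[%classic | q in [set: rat * rat]]; split.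
- exact: card_le_trans (card_image_le _ _) (countableP _).
- split; first by move=> _ [q _ <-]; exact: interval_open.
  move=> x A /= [e /= e0 eA].
  have [q1 /[!in_itv]/= /andP[q1l q1r]] : exists q : rat, ratr q \in `]x - e,
    x[.
    by apply: rat_in_itvoo; rewrite ltrBlDr ltrDl.
  have [q2 /[!in_itv]/= /andP[q2l q2r]] : exists q : rat, ratr q \in `]x, x +
    e[.
    by apply: rat_in_itvoo; rewrite ltrDl.
  exists `]ratr q1, ratr q2[%classic.
    by split; [exists (q1, q2)|rewrite /= in_itv/= q1r].
  move=> z /=; rewrite in_itv/= => /andP[z1 z2]; apply: eA.
  by rewrite /= ltr_norml; apply/andP; split; lra.
- by move=> _ [q _ <-]; exact: interval_open.
Qed.

End countable_basis.

(** * Joint measurability of the heat kernel *)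

Section manifold.
Context (R : realType) (M : ptopologicalType) (n : nat).
Variable S : smooth_manifold R M n.

Lemma manifold_hausdorff : hausdorff_space M.
Proof. by case: S. Qed.

Lemma manifold_second_countable : @second_countable M.
Proof. by case: S. Qed.

Lemma atlas_is_chart c : atlas S c -> is_chart c.
Proof. by case: S => /= ? ? ? ? H ? ? ; exact: H. Qed.

Lemma chart_at_atlas x : atlas S (chart_at S x).
Proof. by case: S => /= ? ? ? ? ? ? H; have [] := H x. Qed.

Lemma chart_at_dom x : cdom (chart_at S x) x.
Proof. by case: S => /= ? ? ? ? ? ? H; have [] := H x. Qed.

(** Closed balls of R^n inside a chart are carried to compact neighbourhoods by
    the inverse chart. *)
Lemma manifold_locally_compact : locally_compact [set: M].
Proof.
move=> x _.
have [odom oim cK cmap_cont cinv_cont] := atlas_is_chart (chart_at_atlas x).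
set c := chart_at S x in odom oim cK cmap_cont cinv_cont.
have cx := chart_at_dom x; rewrite -/c in cx.
have imx : cim c (cmap c x) by exists x.
have /nbhs_closedballP[e eim] : nbhs (cmap c x) (cim c).
  exact: open_nbhs_nbhs.
have cK' : compact (closed_ball (cmap c x) e%:num).
  apply: bounded_closed_compact; last exact: closed_ball_closed.
  rewrite closed_ballE//.
  exists (`|cmap c x| + e%:num); split; first by rewrite num_real.
  move=> B cB z; rewrite /closed_ball_/= => xz; apply: le_trans (ltW cB).
  rewrite -[z](subKr (cmap c x)) (le_trans (ler_normB _ _))//.
  by rewrite lerD2l.
have cU : compact (cinv c @` closed_ball (cmap c x) e%:num).
  apply: continuous_compact cK'.
  apply: continuous_in_subspaceT => z; rewrite inE => /eim; exact: cinv_cont.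
exists (cinv c @` closed_ball (cmap c x) e%:num); last first.
  by split=> //; apply: compact_closed => //; exact: manifold_hausdorff.
have nx : nbhs x (cmap c @^-1` closed_ball (cmap c x) e%:num).
  by apply: (cmap_cont _ cx); apply/nbhs_closedballP; exists e.
have nd : nbhs x (cdom c) by exact: open_nbhs_nbhs.
apply: filterS (filterI nx nd) => z [/= bz dz] _.
by exists (cmap c z) => //; exact: cK.
Qed.

Lemma manifold_completely_regular : @completely_regular_space M.
Proof.
move=> x B; apply: (@locally_compact_completely_regular _ R).
  exact: manifold_locally_compact.
exact: manifold_hausdorff.
Qed.

(** Complete regularity separates x from the complement of U. *)
Lemma bump_function (U : set M) x : open U -> U x ->
  exists phi : M -> R, [/\ continuous phi, phi x = 1 &
    forall z, 0 <= phi z <= \1_U z].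
Proof.
move=> oU Ux.
have /(@uniform_separatorP _ R)[f [fc f01 fx fU]] :
    uniform_separator [set x] (~` U).
  by apply: manifold_completely_regular; [exact: open_closedC|apply].
exists (fun z => 1 - f z); split.
- by move=> z; apply: cvgB; [exact: cvg_cst|exact: fc].
- have -> : f x = 0 by apply: fx; exists x.
  by rewrite subr0.
- move=> z; have : `[0, 1]%classic (f z) by apply: f01; exists z.
  rewrite /= in_itv/= => /andP[f0 f1]; rewrite subr_ge0 f1/= indicE.
  have [Uz|nUz] := pselect (U z); first by rewrite mem_set// lerBlDr lerDl.
  have -> : f z = 1 by apply: fU; exists z.
  by rewrite subrr.
Qed.

End manifold.

Section heat_kernel.
Context (R : realType) (M : ptopologicalType) (n k : nat).
Variables (S : subRiemannian R M n k) (mu : smooth_volume S).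
Variable h : R -> M -> M -> R.
Hypothesis heat_h : is_heat_kernel mu h.

(** Near a point the kernel is its expression in a pair of charts composed with
    the charts themselves. *)
Lemma heat_kernel_continuous t x y : 0 < t ->
  {for (t, (x, y)), continuous (fun p : R * (M * M) => h p.1 p.2.1 p.2.2)}.
Proof.
move=> t0.
pose c := chart_at S x; pose c' := chart_at S y.
have ac : atlas S c by exact: chart_at_atlas.
have ac' : atlas S c' by exact: chart_at_atlas.
have [od _ cK cc _] := atlas_is_chart ac.
have [od' _ cK' cc' _] := atlas_is_chart ac'.
have dx : cdom c x by exact: chart_at_dom.
have dy : cdom c' y by exact: chart_at_dom.
pose G (z : R * 'rV[R]_n * 'rV[R]_n) := h z.1.1 (cinv c z.1.2) (cinv c' z.2).
pose Phi (p : R * (M * M)) := ((p.1, cmap c p.2.1), cmap c' p.2.2).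
have Gc : {for Phi (t, (x, y)), continuous G}.
  have := heat_kernel_smooth heat_h ac ac'.
  move=> /(_ [::] (Phi (t, (x, y)))) [|//].
  by split => //; [exists x|exists y].
have Phic : Phi @ (t, (x, y)) --> Phi (t, (x, y)).
  have c1 : (fun p : R * (M * M) => p.1) @ nbhs (t, (x, y)) --> nbhs t.
    exact: (@cvg_fst _ _ (nbhs t) (nbhs (x, y))).
  have snd_cvg : snd @ nbhs (t, (x, y)) --> nbhs (x, y).
    exact: (@cvg_snd _ _ (nbhs t) (nbhs (x, y))).
  have c2 : (fun p : R * (M * M) => cmap c p.2.1) @ nbhs (t, (x, y)) -->
      nbhs (cmap c x).
    apply: (cvg_comp snd (fun q : M * M => cmap c q.1) snd_cvg).
    exact: (cvg_comp _ _ (@cvg_fst _ _ (nbhs x) (nbhs y) _) (cc x dx)).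
  have c3 : (fun p : R * (M * M) => cmap c' p.2.2) @ nbhs (t, (x, y)) -->
      nbhs (cmap c' y).
    apply: (cvg_comp snd (fun q : M * M => cmap c' q.2) snd_cvg).
    exact: (cvg_comp _ _ (@cvg_snd _ _ (nbhs x) (nbhs y) _) (cc' y dy)).
  exact: (cvg_pair (cvg_pair c1 c2) c3).
have GPhi : h t x y = G (Phi (t, (x, y))) by rewrite /G /= cK// cK'.
rewrite /prop_for /continuous_at [X in _ --> X](_ : _ = G (Phi (t, (x, y))))//.
apply: cvg_trans (cvg_comp _ _ Phic Gc); apply: near_eq_cvg.
exists (setT, cdom c `*` cdom c') => /=.
  split; first exact: filterT.
  by exists (cdom c, cdom c') => //; split; apply: open_nbhs_nbhs.
by move=> [s [a b]] [/= _ [da db]]; rewrite /G /= cK// cK'.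
Qed.

Definition heat_flow : R -> M -> M -> R := fun t x z =>
  if 0 < t then h t x z else 0.

(** The product sigma-algebra contains the open sets because all the factors
    have countable bases. *)
Lemma open_measurable_product (A : set (R * (M * M))) : open A ->
  measurable (A : set (R * (borel M * borel M))%type).
Proof.
move=> oA.
have bM : countable_basis_in (fun B : set M => measurable (B : set (borel M))).
  have [B cB [oB nB]] := manifold_second_countable S.
  exists B; split => // U BU; apply: sub_sigma_algebra; exact: oB.
apply: (countable_basis_open (m := fun B : set (R * (M * M)) =>
  measurable (B : set (R * (borel M * borel M))%type))) oA.
- exact: measurable0.
- by move=> F mF; exact: bigcupT_measurable.
- apply: (countable_basis_prod (mX := fun B : set R => measurable B)
    (mY := fun B : set (M * M) =>
      measurable (B : set (borel M * borel M)%type))).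
  + by move=> B C mB mC; exact: measurableX.
  + have [B [cB bB oB]] := countable_basis_real R.
    by exists B; split => // U /oB; exact: open_measurable.
  + apply: (countable_basis_prod _ bM bM) => B C mB mC; exact: measurableX.
Qed.

Lemma measurable_heat_flow :
  measurable_fun [set: (R * (borel M * borel M))%type]
    (fun p => heat_flow p.1 p.2.1 p.2.2).
Proof.
have oD : open [set p : R * (M * M) | 0 < p.1].
  rewrite (_ : [set p | _] = fst @^-1` [set t : R | 0 < t])//.
  by apply: open_comp; [move=> p _; exact: cvg_fst|exact: open_gt].
have mD : measurable ([set p | 0 < p.1] : set (R * (borel M * borel M))%type).
  exact: open_measurable_product.
apply: measurable_fun_if => //.
- by apply: measurable_fun_ltr.
- rewrite setTI (_ : _ @^-1` _ = [set p | 0 < p.1]); last first.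
    by apply/seteqP; split.
  apply: (measurability _ (RGenOInfty.measurableE R)) => _ [_ [r ->] <-].
  apply: open_measurable_product.
  rewrite openE => -[t [x y]] [/= t0]; rewrite in_itv/= andbT => rh.
  apply: filterI; first by apply: open_nbhs_nbhs.
  apply: (heat_kernel_continuous t0); apply: open_nbhs_nbhs.
  by split; [exact: interval_open|rewrite /= in_itv/= rh].
Qed.

End heat_kernel.

(** * The heat kernel as a sub-Markov kernel *)

(** The structure is rebuilt on the same function, so that integrals against
    the two measures can be exchanged by rewriting. *)
Lemma sigma_finite_measureE d (T : measurableType d) (R : realType)
    (m : {measure set T -> \bar R}) : sigma_finite setT m ->
  exists m' : {sigma_finite_measure set T -> \bar R},
    (m' : {measure set T -> \bar R}) = m.
Proof.
case: m => f c H; pose m0 : {measure set T -> \bar R} := Measure.Pack c.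
pose m1 : {sigma_finite_measure set T -> \bar R} :=
  HB.pack f c (Measure_isSigmaFinite.Build _ _ _ m0 H).
by exists m1; case: c @m0 H @m1.
Qed.

Section heat_flow.
Context (R : realType) (M : ptopologicalType) (n k : nat).
Variables (S : subRiemannian R M n k) (mu : smooth_volume S).
Variable h : R -> M -> M -> R.
Hypothesis heat_h : is_heat_kernel mu h.

(** The kernel at time 1 from a fixed point is positive and has integral at
    most 1, so these sets exhaust the manifold and have finite measure. *)
Definition superlevel_exhaustion (i : nat) : set M :=
  [set z | i.+1%:R^-1 < h 1 z point].

Lemma open_exhaustion i : open (superlevel_exhaustion i).
Proof.
rewrite openE => z /= hz.
have hc : (fun z => h 1 z point) @ z --> h 1 z point.
  apply: (@cvg_comp _ _ _ (fun z : M => (1 : R, (z, point : M)))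
    (fun p : R * (M * M) =>
      h p.1 p.2.1 p.2.2) _ (nbhs (1 : R, (z, point : M)))).
    exact: (cvg_pair (cvg_cst (1 : R)) (cvg_pair cvg_id (cvg_cst (point : M)))).
  by have := heat_kernel_continuous heat_h (x := z) (y := point) ltr01; exact.
by apply: (cvgr_gt _ hc).
Qed.

Lemma measurable_exhaustion i : measurable (superlevel_exhaustion i :
  set (borel M)).
Proof. by apply: sub_sigma_algebra; exact: open_exhaustion. Qed.

Lemma heat_kernel_measurable_l t z : 0 < t ->
  measurable_fun setT (fun x : borel M => h t x z).
Proof.
move=> t0.
have := measurableT_comp (measurable_heat_flow heat_h)
  (measurable_fun_pair (measurable_cst t)
    (measurable_fun_pair (@measurable_id _ (borel M) setT)
      (measurable_cst (z : borel M)))).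
by apply: eq_measurable_fun => x _; rewrite /= /heat_flow t0.
Qed.

(** Markov's inequality for the kernel, whose integral is at most 1. *)
Lemma exhaustion_lty i : (vol mu (superlevel_exhaustion i) < +oo)%E.
Proof.
have m1 : measurable_fun setT (fun x : borel M => h 1 x point).
  exact: heat_kernel_measurable_l.
have i0 : 0 < i.+1%:R^-1 :> R by rewrite invr_gt0.
have := le_integral_abse (vol mu) measurableT (g := fun x => (h 1 x point)%:E)
  (iffRL (measurable_EFinP _ _) m1) i0.
rewrite setTI => le.
have le1 : (\int[vol mu]_x `|(h 1 x point)%:E| <= 1)%E.
  apply: le_trans (heat_kernel_submarkov heat_h point ltr01).
  under eq_integral => x _ do
    rewrite gee0_abs ?lee_fin ?(ltW (heat_kernel_gt0 heat_h x point ltr01))//.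
  by [].
have sub : (vol mu (superlevel_exhaustion i) <=
    vol mu [set x | ((i.+1%:R^-1)%:E <= `|(h 1 x point)%:E|)%E])%E.
  apply: le_measure; rewrite ?inE.
  - exact: measurable_exhaustion.
  - rewrite -[X in measurable X]setTI.
    apply: emeasurable_fun_c_infty => //.
    by apply: measurableT_comp => //; exact/measurable_EFinP.
  - move=> z /= hz; rewrite lee_fin ger0_norm; first exact: ltW.
    exact: ltW (heat_kernel_gt0 heat_h z point ltr01).
apply: le_lt_trans sub _.
rewrite -(@lte_pmul2l _ (i.+1%:R^-1)%:E)//.
apply: le_lt_trans le _; apply: le_lt_trans le1 _.
by rewrite gt0_muley ?ltry.
Qed.

Lemma exhaustion_near z : \forall i \near \oo, superlevel_exhaustion i z.
Proof.
have h0 := heat_kernel_gt0 heat_h z point ltr01.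
near=> i; rewrite /superlevel_exhaustion/=.
near: i; exact: near_infty_natSinv_lt (PosNum h0).
Unshelve. all: by end_near. Qed.

Lemma vol_sigma_finite : sigma_finite setT (vol mu).
Proof.
exists superlevel_exhaustion.
  apply/seteqP; split => // z _.
  have [N _ HN] := exhaustion_near z.
  by exists N => //; apply: HN => /=.
by move=> i; split; [exact: measurable_exhaustion|exact: exhaustion_lty].
Qed.

Hypothesis h_bounded : forall t, 0 < t ->
  exists B : R, forall x z, h t x z <= B.

Variable mu' : {sigma_finite_measure set (borel M) -> \bar R}.
Hypothesis mu'E : (mu' : {measure set (borel M) -> \bar R}) = vol mu.

Let mu'F : (mu' : set (borel M) -> \bar R) = vol mu.
Proof. by rewrite -mu'E. Qed.

Let heat_kernel_ge0 t x z : 0 < t -> 0 <= h t x z.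
Proof. by move=> t0; exact: ltW (heat_kernel_gt0 heat_h x z t0). Qed.

Lemma heat_flowE t : 0 < t -> heat_flow h t = h t.
Proof.
by move=> t0; apply/funext => x; apply/funext => z; rewrite /heat_flow t0.
Qed.

Lemma sub_markov_heat_flow :
  sub_markov_flow mu' (heat_flow h : R -> borel M -> borel M -> R).
Proof.
split.
- exact: (measurable_heat_flow heat_h).
- by move=> t x z; rewrite /heat_flow leNgt => /negbTE ->.
- by move=> t x z; rewrite /heat_flow; case: ifPn => // t0;
    exact: heat_kernel_ge0.
- move=> t x z; rewrite /heat_flow; case: ifPn => // t0.
  exact: (heat_kernel_sym heat_h).
- move=> t s x z t0 s0; rewrite !heat_flowE ?addr_gt0// mu'F.
  by rewrite (heat_kernel_semigroup heat_h x z t0 s0).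
- move=> t x; rewrite mu'F; have [t0|t0] := ltP 0 t.
    rewrite heat_flowE//; apply: le_trans (heat_kernel_submarkov heat_h x t0).
    by under eq_integral do rewrite (heat_kernel_sym heat_h x _ t0).
  by rewrite /heat_flow ltNge t0/= integral0.
- move=> t; have [t0|t0] := ltP 0 t.
    by have [B hB] := h_bounded t0; exists B => x z; rewrite heat_flowE.
  by exists 0 => x z; rewrite /heat_flow ltNge t0.
Qed.

Lemma continuous_borel_measurable (phi : M -> R) : continuous phi ->
  measurable_fun setT (phi : borel M -> R).
Proof.
move=> phi_cont; apply: (measurability _ (RGenOInfty.measurableE R)).
move=> _ [_ [r ->] <-]; rewrite setTI; apply: sub_sigma_algebra.
by apply: open_comp => // x _; exact: phi_cont.
Qed.

(** Convergence to the Dirac mass at x, tested on a bump function that is 1 at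
    x and lies below the indicator of U. *)
Lemma heat_kernel_concentrates (U : set M) x (e : R) : open U -> U x -> 0 < e ->
  exists2 r : R, 0 < r & forall s, 0 < s < r ->
    ((1 - e)%:E <= \int[mu']_z (heat_flow h s x z * \1_U z)%:E)%E.
Proof.
move=> oU Ux e0.
have [phi [phi_cont phix phi_le]] := bump_function S oU Ux.
have [_ _ /(_ phi phi_cont)] := heat_kernel_fundamental heat_h x.
have phi_bounded : exists B : R, forall z, `|phi z| <= B.
  exists 1 => z; have /andP[phi0 phi1] := phi_le z.
  by rewrite ger0_norm// (le_trans phi1)// indicE lern1; case: (_ \in _).
move=> /(_ phi_bounded);
  rewrite phix => /fine_cvgP[fin /cvgrPdist_le /(_ _ e0) close].
have [r /= r0 hr] := filterI fin close.
exists r => // s /andP[s0 sr].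
have [|/=] := hr s _ s0.
  by rewrite /ball_/= sub0r normrN gtr0_norm.
move=> int_fin; rewrite ler_norml => /andP[_ int_ge].
rewrite mu'F; apply: (@le_trans _ _ (\int[vol mu]_z (h s z x * phi z)%:E)%E).
  by rewrite -(fineK int_fin) lee_fin; lra.
have mphi := continuous_borel_measurable phi_cont.
apply: ge0_le_integral => //.
- by move=> z _; rewrite lee_fin mulr_ge0 ?heat_kernel_ge0//;
    case/andP: (phi_le z).
- apply/measurable_EFinP; apply: measurable_funM => //.
  exact: heat_kernel_measurable_l.
- apply/measurable_EFinP; apply: measurable_funM.
    exact: (measurable_flow sub_markov_heat_flow).
  by apply: measurable_indic; apply: sub_sigma_algebra.
- move=> z _; rewrite lee_fin heat_flowE// (heat_kernel_sym heat_h x z s0).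
  by rewrite ler_wpM2l ?heat_kernel_ge0//; case/andP: (phi_le z).
Qed.

End heat_flow.

(** * Global solutions on the sub-Riemannian manifold *)

Unset Implicit Arguments.
Set Strict Implicit.
Set Printing Implicit Defensive.

Theorem theorem3p4 (R : realType) (M : ptopologicalType) (n k : nat)
    (S : subRiemannian R M n k) (mu : smooth_volume S)
    (h : R -> M -> M -> R) (heat_h : is_heat_kernel mu h)
    (C3 C4 C7 C8 a b : R)
    (C3_gt0 : 0 < C3) (C4_gt0 : 0 < C4) (C7_gt0 : 0 < C7) (C8_gt0 : 0 < C8)
    (a_gt0 : 0 < a) (b_ge0 : 0 <= b)
    (h_small : forall (t : R) (x y : M), 0 < t -> t < 1 ->
      h t x y <= C3 * t `^ (- (b / 2)) * expR (- (C4 * cc_dist S x y ^+ 2 / t)))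
    (h_large : forall (t : R) (x y : M), 1 <= t ->
      h t x y <= C7 * t `^ (- (a / 2)) * expR (- (C8 * cc_dist S x y ^+ 2 / t)))
    (p : R) (p_gt : 1 + 2 / a < p)
    (gamma : R) (gamma_gt0 : 0 < gamma)
    (f : R -> R)
    (f_ge0 : forall v, 0 <= v -> 0 <= f v)
    (f_cont : {within `[0, +oo[, continuous f})
    (f_incr : forall v w, 0 <= v -> v <= w -> f v <= f w)
    (K1 : R) (K1_gt0 : 0 < K1)
    (f_le : forall v, 0 <= v -> f v <= K1 * v `^ p) :
  exists eps C : R, [/\ 0 < eps, 0 < C &
    forall (q : R) (u0 : M -> R) (y : M),
      1 <= q -> (u0 : borel M -> R) \in Lfun (vol mu) q%:E ->
      (forall x, 0 <= u0 x <= eps * h gamma x y) ->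
      exists u : R -> M -> R,
        [/\ Lq_curve mu q u,
            forall t x, 0 <= t -> 0 <= u t x,
            global_solution mu h f u0 u &
            forall t x, 0 < t -> 0 <= u t x <= C * h (t + gamma) x y]].
Proof.
have gauss_le1 (c x t : R) : 0 < c -> 0 < t -> expR (- (c * x ^+ 2 / t)) <= 1.
  move=> c0 t0; rewrite -expR0 ler_expR oppr_le0.
  by rewrite divr_ge0 ?(ltW t0)// mulr_ge0 ?sqr_ge0// ltW.
have h_small' t x y : 0 < t -> t < 1 -> h t x y <= C3 * t `^ (- (b / 2)).
  move=> t0 t1; apply: le_trans (h_small t x y t0 t1) _.
  by rewrite ler_piMr ?mulr_ge0 ?powR_ge0 ?(ltW C3_gt0)// gauss_le1.
have h_large' t x y : 1 <= t -> h t x y <= C7 * t `^ (- (a / 2)).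
  move=> t1; apply: le_trans (h_large t x y t1) _.
  by rewrite ler_piMr ?mulr_ge0 ?powR_ge0 ?(ltW C7_gt0)// gauss_le1//
    (lt_le_trans ltr01).
have h_bounded t : 0 < t -> exists B : R, forall x z, h t x z <= B.
  move=> t0; have [t1|t1] := ltP t 1.
    by exists (C3 * t `^ (- (b / 2))) => x z; exact: h_small'.
  by exists (C7 * t `^ (- (a / 2))) => x z; exact: h_large'.
have [mu' mu'E] := sigma_finite_measureE (vol_sigma_finite heat_h).
have K := sub_markov_heat_flow heat_h h_bounded mu'E.
have strong w : pos_integrable mu' w -> continuous_at_start mu' (heat_flow h) w.
  have mu'F : (mu' : set (borel M) -> \bar R) = vol mu by rewrite -mu'E.
  apply: (@L1_continuous_at_start _ (borel M) R mu' _ K (@open M) _ _ _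
    (superlevel_exhaustion h)).
  - by [].
  - by move=> U V oU oV; exact: openI.
  - exact: (heat_kernel_concentrates heat_h h_bounded mu'E).
  - exact: (open_exhaustion heat_h).
  - by move=> i; rewrite mu'F; exact: (exhaustion_lty heat_h).
  - exact: (exhaustion_near heat_h).
pose A : R := C7 + C3 * gamma `^ (- (b / 2)).
have A0 : 0 < A by rewrite ltr_pwDl// mulr_ge0 ?powR_ge0// ltW.
have decay t x y : gamma <= t -> heat_flow h t x y <= A * t `^ (- (a / 2)).
  move=> gt; have t0 : 0 < t by exact: lt_le_trans gt.
  rewrite heat_flowE//; have [t1|t1] := ltP t 1; last first.
    apply: le_trans (h_large' _ _ _ t1) _; rewrite ler_wpM2r ?powR_ge0//.
    by rewrite lerDl mulr_ge0 ?powR_ge0// ltW.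
  apply: le_trans (h_small' _ _ _ t0 t1) _.
  apply: (@le_trans _ _ (C3 * gamma `^ (- (b / 2)))).
    rewrite ler_wpM2l ?(ltW C3_gt0)// !powRN lef_pV2 ?posrE ?powR_gt0//.
    by apply: ge0_ler_powR;
      rewrite ?nnegrE ?divr_ge0 ?(ltW gamma_gt0) ?(ltW t0).
  rewrite -[leLHS]mulr1; apply: ler_pM => //.
  - by rewrite mulr_ge0 ?powR_ge0// ltW.
  - by rewrite lerDr ltW.
  - rewrite powRN -[leLHS]invr1 lef_pV2 ?posrE ?powR_gt0//.
    apply: (@le_trans _ _ (1 `^ (a / 2))); last by rewrite powR1.
    apply: ge0_ler_powR; rewrite ?nnegrE ?(ltW t0) ?(ltW t1)//.
    by rewrite divr_ge0// ltW.
have p_gt1 : 1 < p.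
  by apply: le_lt_trans p_gt; rewrite lerDl divr_ge0// ltW.
have supercritical : 1 < a / 2 * (p - 1).
  have : 2 / a < p - 1 by lra.
  by rewrite ltr_pdivrMr// => ?; lra.
have [eps [C [eps0 C0 sol]]] := global_solution_exists K strong gamma_gt0 A0
  decay p_gt1 supercritical f_ge0 f_cont f_incr K1_gt0 f_le.
exists eps, C; split => // q u0 y q1 u0L u0_le.
have mu0 : measurable_fun setT (u0 : borel M -> R).
  by move: u0L; rewrite inE => /andP[]; rewrite inE.
have [|u [[uL u_cont] u_le iF u_mild]] := sol q u0 y q1 mu0.
  by move=> x; rewrite heat_flowE.
have v0 x : 0 <= u0 x by case/andP: (u0_le x).
have iu0 : pos_integrable mu' u0.
  apply: pos_integrable_le (pos_integrableZ (ltW eps0)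
    (pos_integrable_flow K gamma y)) => //.
  by move=> x; rewrite heat_flowE.
have semigroupE t v x : 0 <= t ->
      heat_semigroup mu h t v x = act mu' (heat_flow h) t v x.
  rewrite /heat_semigroup /act le_eqVlt => /predU1P[<-|t0];
    first by rewrite eqxx.
  by rewrite heat_flowE// -mu'E.
have integrableE (g : borel M -> \bar R) : (vol mu).-integrable setT g =
    mu'.-integrable setT g by rewrite -mu'E.
exists u; split.
- by rewrite /Lq_curve -mu'E.
- by move=> t x /(u_le t x)/andP[].
- move=> t x t0; have [iD uE] := u_mild t x t0; split.
  + move=> t_gt0; rewrite integrableE -(heat_flowE h t_gt0).
    exact: pos_integrable_integrable (pos_integrable_flowM K t x iu0).
  + move=> s s0 st; have ts : 0 < t - s by rewrite subr_gt0.
    rewrite integrableE -(heat_flowE h ts).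
    exact: pos_integrable_integrable (pos_integrable_flowM K (t - s) x (iF s)).
  + apply: eq_integrable iD => // s; rewrite inE/= in_itv/= => /andP[_ st].
    by rewrite semigroupE// subr_ge0.
  rewrite semigroupE// uE; congr (_ + _)%E; apply: eq_integral => s.
  by rewrite inE/= in_itv/= => /andP[_ st]; rewrite semigroupE// subr_ge0.
- move=> t x t0; rewrite -(heat_flowE h (addr_gt0 t0 gamma_gt0)).
  exact/u_le/ltW.
Qed.
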